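(* For every $\alpha\in(0,1)$ there exists $\mathsf K_\alpha\in(0,\infty)$ such that for every $p\in[1,\infty)$, every normed space $(X,\|\cdot\|_X)$, every $n\in\mathbb N$ and every $f:\{-1,1\}^n\to X$, $$\Big\|f-\int f\,d\mu_\alpha^n\Big\|_{L_p(\mu_\alpha^n;X)}\le\mathsf K_\alpha(\log n+1)\Big(\int_{\{-1,1\}^n}\Big\|\sum_{i=1}^n\delta_i\partial_i^\alpha f\Big\|_{L_p(\mu_\alpha^n;X)}^pd\sigma_n(\delta)\Big)^{1/p}.$$ If additionally $X$ has finite cotype, then there exists $\mathsf K_{p,\alpha}(X)\in(0,\infty)$ (depending only on $p,\alpha,X$) such that for all $n$ and $f:\{-1,1\}^n\to X$, $$\Big\|f-\int f\,d\mu_\alpha^n\Big\|_{L_p(\mu_\alpha^n;X)}\le\mathsf K_{p,\alpha}(X)\Big(\int_{\{-1,1\}^n}\Big\|\sum_{i=1}^n\delta_i\partial_i^\alpha f\Big\|_{L_p(\mu_\alpha^n;X)}^pd\sigma_n(\delta)\Big)^{1/p}.$$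
   Context: $\mu_\alpha$ is the measure on $\{-1,1\}$ with $\mu_\alpha\{1\}=\alpha$, $\mu_\alpha\{-1\}=1-\alpha$; $\mu_\alpha^n$ its $n$-fold product; $\sigma_n$ the uniform probability on $\{-1,1\}^n$. $\partial_i^\alpha f(x)=f(x)-\alpha f(x_1,\dots,x_{i-1},1,x_{i+1},\dots,x_n)-(1-\alpha)f(x_1,\dots,x_{i-1},-1,x_{i+1},\dots,x_n)$. For fixed $\delta$, $\|\sum_i\delta_i\partial_i^\alpha f\|_{L_p(\mu_\alpha^n;X)}=(\int\|\sum_i\delta_i\partial_i^\alpha f(x)\|_X^pd\mu_\alpha^n(x))^{1/p}$. $X$ has finite cotype if for some $q\in[2,\infty)$ and $C<\infty$, $\int\|\sum_{i=1}^nx_iv_i\|_X^qd\sigma_n(x)\ge C^{-q}\sum_i\|v_i\|_X^q$ for all $n$ and $v_i\in X$. *)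

(* Defs.v *)
From HB Require Import structures.
From mathcomp Require Import all_boot all_order all_algebra.
From mathcomp Require Import all_classical all_reals.
From mathcomp Require Import topology normedtype exp.
Set Implicit Arguments. Unset Strict Implicit. Unset Printing Implicit Defensive.
Import Order.TTheory GRing.Theory Num.Theory.
Import numFieldNormedType.Exports.
Local Open Scope ring_scope.

(* The discrete cube {-1,1}^n; coordinate [true] stands for +1, [false] for -1. *)
Definition cube (n : nat) := {ffun 'I_n -> bool}.

Section Defs.
Variable R : realType.

Definition sgn (b : bool) : R := if b then 1 else -1.

Definition mu_a (a : R) (n : nat) (x : cube n) : R :=
  \prod_(i < n) (if x i then a else 1 - a).

Definition sigma_n (n : nat) (x : cube n) : R := (2 ^+ n)^-1.

Definition upd (n : nat) (x : cube n) (i : 'I_n) (b : bool) : cube n :=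
  [ffun j => if j == i then b else x j].

Variable X : normedModType R.

Definition dpart (a : R) (n : nat) (f : cube n -> X) (i : 'I_n) (x : cube n) : X :=
  f x - a *: f (upd x i true) - (1 - a) *: f (upd x i false).

Definition expect (a : R) (n : nat) (f : cube n -> X) : X :=
  \sum_(x : cube n) mu_a a x *: f x.

Definition Lpnorm (a p : R) (n : nat) (g : cube n -> X) : R :=
  (\sum_(x : cube n) mu_a a x * (`|g x| `^ p)) `^ p^-1.

Definition rhs_avg (a p : R) (n : nat) (f : cube n -> X) : R :=
  (\sum_(d : cube n) sigma_n d *
      (Lpnorm a p (fun x => \sum_(i < n) sgn (d i) *: dpart a f i x)) `^ p) `^ p^-1.

End Defs.

Definition finite_cotype (R : realType) (X : normedModType R) : Prop :=
  exists (q C : R), 2 <= q /\ 0 < C /\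
    forall (n : nat) (v : 'I_n -> X),
      C `^ (- q) * \sum_(i < n) `|v i| `^ q <=
      \sum_(x : cube n) sigma_n R x * `|\sum_(i < n) sgn R (x i) *: v i| `^ q.

(* Main.v *)
(** Write [T_r] for the noise operator that keeps each coordinate with
    probability [r] and resamples it from mu_a otherwise, so that [T_1 f = f]
    and [T_0 f] is the mean of [f].  Its derivative in [r] at [x] is the average
    over [y ~ T_r(x, .)] of [sum_i e(x_i, y_i) d_i f(y)] for an explicit
    one-coordinate weight [e] which, given [y], is centred and takes a bounded
    value with high probability and the value [- 1 / (1 - r)] with probability
    at most [1 - r].  By convexity the [e(x_i, y_i)] may be replaced by
    [C / (1 - r)] times random signs, which costs [C / (1 - r)] and, integrated
    up to [1 - r = 1 / n], gives the logarithm; for [r] closer to 1 the crude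
    bound [O(n)] on the derivative suffices.  If [2 (1 - r) <= 1 / m] one may
    even replace them by signs restricted to a Bernoulli(1/m) random set of
    coordinates.  That set is one colour class of a uniform m-colouring, and
    cotype (with Kahane's inequality to change exponents) shows that an average
    class carries only a fraction [m ^ - s] of the Rademacher sum; this gain
    makes the integral converge.  The integral is replaced by a sum over
    [r = 1 - 2 ^ - j] and a mean value inequality for polynomial curves. *)

Require Import Defs.
From HB Require Import structures.
From mathcomp Require Import all_boot all_order all_algebra.
From mathcomp Require Import all_classical all_reals.
From mathcomp Require Import topology normedtype exp.
From mathcomp Require Import ring lra.
Set Implicit Arguments. Unset Strict Implicit. Unset Printing Implicit Defensive.
Import Order.TTheory GRing.Theory Num.Theory.
Import numFieldNormedType.Exports.
Local Open Scope ring_scope.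

(** * Power means *)

Section Power.
Variable R : realType.
Implicit Types (p x y : R).

(** The tangent line of the power function at [y], obtained from Young's inequality for [x] and
    [y ^ (p - 1)]. The conjugate exponent degenerates at [p = 1], hence the separate case. *)
Lemma powR_tangent p x y : 1 <= p -> 0 <= x -> 0 <= y ->
  p * y `^ (p - 1) * x <= x `^ p + (p - 1) * y `^ p.
Proof.
move=> p1 x0 y0; have p0 : 0 < p by lra.
have [->|pn1] := eqVneq p 1.
  by rewrite subrr powRr0 powRr1 // mul0r addr0 !mul1r.
have p10 : 0 < p - 1 by rewrite subr_gt0 lt_neqAle eq_sym pn1.
have := @conjugate_powR R x (y `^ (p - 1)) p (p / (p - 1)) x0 (powR_ge0 _ _) p0.
have E : (p - 1) * (p / (p - 1)) = p by field; rewrite gt_eqF.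
rewrite divr_gt0// -powRrM E => /(_ isT) H.
have /H {}H : p^-1 + (p / (p - 1))^-1 = 1 by field; rewrite !gt_eqF.
move: H; rewrite -(ler_pM2l p0) => H.
have -> : p * y `^ (p - 1) * x = p * (x * y `^ (p - 1)) by ring.
apply: le_trans H _; rewrite le_eqVlt; apply/orP; left; apply/eqP.
by field; rewrite !gt_eqF.
Qed.

(** Average the tangent inequality taken at the mean [m]: the linear term becomes [p m ^ p]. *)
Lemma powR_jensen (T : finType) (w g : T -> R) p : 1 <= p ->
  (forall t, 0 <= w t) -> (forall t, 0 <= g t) -> \sum_t w t = 1 ->
  (\sum_t w t * g t) `^ p <= \sum_t w t * g t `^ p.
Proof.
move=> p1 w0 g0 w1; set m := \sum_t _.
have m0 : 0 <= m by apply: sumr_ge0 => t _; apply: mulr_ge0.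
have : \sum_t w t * (p * m `^ (p - 1) * g t) <=
       \sum_t w t * (g t `^ p + (p - 1) * m `^ p).
  by apply: ler_sum => t _; apply: ler_wpM2l => //; apply: powR_tangent.
under eq_bigr do rewrite mulrCA.
under [in leRHS]eq_bigr do rewrite mulrDr.
rewrite -mulr_sumr big_split /= -mulr_suml w1 -/m mul1r -mulrA [_ * m]mulrC.
rewrite mulr_powRB1 //; lra.
Qed.

Lemma powR_convex p x y (t : R) : 1 <= p -> 0 <= x -> 0 <= y -> 0 <= t <= 1 ->
  (t * x + (1 - t) * y) `^ p <= t * x `^ p + (1 - t) * y `^ p.
Proof.
move=> p1 x0 y0 /andP[t0 t1].
have := @powR_jensen bool (fun b => if b then t else 1 - t)
  (fun b => if b then x else y) p p1.
by rewrite !big_bool /=; apply; [case; lra|case; lra|ring].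
Qed.

Lemma powR_le_mono p x y : 0 <= p -> 0 <= x -> x <= y -> x `^ p <= y `^ p.
Proof. by move=> p0 x0 xy; apply: ge0_ler_powR => //; rewrite nnegrE //; lra. Qed.

Lemma powRK p x : 0 < p -> 0 <= x -> (x `^ p) `^ p^-1 = x.
Proof. by move=> p0 x0; rewrite -powRrM mulfV ?gt_eqF // powRr1. Qed.

Lemma powRVK p x : 0 < p -> 0 <= x -> (x `^ p^-1) `^ p = x.
Proof. by move=> p0 x0; rewrite -powRrM mulVf ?gt_eqF // powRr1. Qed.

Lemma powRV p x : 0 <= x -> x^-1 `^ p = (x `^ p)^-1.
Proof.
by move=> x0; rewrite -(powR_inv1 x0) powRAC powR_inv1 // powR_ge0.
Qed.

Lemma powR_rootP p x y : 0 < p -> 0 <= x -> 0 <= y ->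
  (x `^ p^-1 <= y) = (x <= y `^ p).
Proof.
move=> p0 x0 y0; apply/idP/idP => h.
  by rewrite -(powRVK p0 x0); apply: powR_le_mono => //; [lra|exact: powR_ge0].
by rewrite -(powRK p0 y0); apply: powR_le_mono => //; rewrite invr_ge0; lra.
Qed.

(** [(g + h) / (a + b)] is the convex combination of [g / a] and [h / b] with weights [a / (a + b)]
    and [b / (a + b)], so convexity of the power suffices. *)
Lemma powR_minkowski (T : finType) (w g h : T -> R) p (A B : R) : 1 <= p ->
  (forall t, 0 <= w t) -> (forall t, 0 <= g t) -> (forall t, 0 <= h t) ->
  0 <= A -> 0 <= B ->
  \sum_t w t * g t `^ p <= A `^ p -> \sum_t w t * h t `^ p <= B `^ p ->
  \sum_t w t * (g t + h t) `^ p <= (A + B) `^ p.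
Proof.
move=> p1 w0 g0 h0 A0 B0 gA hB; have p0 : 0 < p by lra.
(* enlarging both radii avoids dividing by zero *)
have main (a b : R) : 0 < a -> 0 < b ->
    \sum_t w t * g t `^ p <= a `^ p -> \sum_t w t * h t `^ p <= b `^ p ->
    \sum_t w t * (g t + h t) `^ p <= (a + b) `^ p.
  move=> a0 b0 ga hb; have ab0 : 0 < a + b by lra.
  set c := (a + b) `^ p.
  have step t : w t * (g t + h t) `^ p <=
      c * (a / (a + b)) * (a `^ p)^-1 * (w t * g t `^ p) +
      c * (b / (a + b)) * (b `^ p)^-1 * (w t * h t `^ p).
    have -> : g t + h t = (a + b) * ((a / (a + b)) * (g t / a)
                         + (1 - a / (a + b)) * (h t / b)).
      by field; rewrite !gt_eqF.
    have gta : 0 <= g t / a by apply: divr_ge0 => //; exact: ltW.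
    have htb : 0 <= h t / b by apply: divr_ge0 => //; exact: ltW.
    have r01 : 0 <= a / (a + b) <= 1.
      apply/andP; split; first by apply: divr_ge0; lra.
      by rewrite ler_pdivrMr // mul1r; lra.
    rewrite powRM; [|lra|case/andP: r01 => r0 r1; apply: addr_ge0; apply: mulr_ge0 => //; lra].
    have H := powR_convex p1 gta htb r01.
    have E1 : (g t / a) `^ p = g t `^ p / a `^ p.
      by rewrite powRM ?powRV // ?invr_ge0 ltW.
    have E2 : (h t / b) `^ p = h t `^ p / b `^ p.
      by rewrite powRM ?powRV // ?invr_ge0 ltW.
    rewrite E1 E2 in H.
    have cw : 0 <= w t * c by apply: mulr_ge0 => //; exact: powR_ge0.
    rewrite -/c mulrA; apply: le_trans (ler_wpM2l cw H) _.
    have -> : 1 - a / (a + b) = b / (a + b) by field; rewrite gt_eqF.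
    by rewrite le_eqVlt; apply/orP; left; apply/eqP; ring.
  apply: le_trans (ler_sum _ (fun t _ => step t)) _.
  rewrite big_split /= -!mulr_sumr.
  have ap : 0 < a `^ p by exact: powR_gt0.
  have bp : 0 < b `^ p by exact: powR_gt0.
  have c0 : 0 <= c by exact: powR_ge0.
  apply: (@le_trans _ _ (c * (a / (a + b)) * (a `^ p)^-1 * a `^ p +
                         c * (b / (a + b)) * (b `^ p)^-1 * b `^ p)).
    by apply: lerD; apply: ler_wpM2l => //; apply: divr_ge0; rewrite ?powR_ge0 //;
      apply: mulr_ge0 => //; apply: divr_ge0; lra.
  by rewrite !mulfVK ?gt_eqF // -mulrDr -mulrDl mulfV ?mulr1 // gt_eqF.
have S0 : 0 <= \sum_t w t * (g t + h t) `^ p.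
  by apply: sumr_ge0 => t _; apply: mulr_ge0 => //; exact: powR_ge0.
rewrite -powR_rootP ?addr_ge0 //; apply/ler_addgt0Pr => e e0.
have -> : A + B + e = (A + e / 2) + (B + e / 2) by field.
rewrite powR_rootP //; last lra.
apply: main; [lra|lra| |].
  by apply: le_trans gA _; apply: powR_le_mono; lra.
by apply: le_trans hB _; apply: powR_le_mono; lra.
Qed.

End Power.

(** * Sums over product spaces and convex order *)

Section ProductSums.

Definition fcons (T : Type) n (t : T) (x : {ffun 'I_n -> T}) : {ffun 'I_n.+1 -> T} :=
  [ffun i => if unlift ord0 i is Some j then x j else t].

Lemma fcons0 (T : Type) n (t : T) (x : {ffun 'I_n -> T}) : fcons t x ord0 = t.
Proof. by rewrite ffunE unlift_none. Qed.

Lemma fconsS (T : Type) n (t : T) (x : {ffun 'I_n -> T}) i :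
  fcons t x (lift ord0 i) = x i.
Proof. by rewrite ffunE liftK. Qed.

Lemma big_fcons (V : Type) (idx : V) (op : Monoid.law idx) (T : Type) n
    (F : 'I_n.+1 -> T -> V) (t : T) (x : {ffun 'I_n -> T}) :
  \big[op/idx]_i F i (fcons t x i) =
  op (F ord0 t) (\big[op/idx]_i F (lift ord0 i) (x i)).
Proof.
rewrite big_ord_recl fcons0; congr (op _ _).
by apply: eq_bigr => i _; rewrite fconsS.
Qed.

Lemma sum_ffun0 (V : nmodType) (T : finType) (F : {ffun 'I_0 -> T} -> V) x0 :
  \sum_x F x = F x0.
Proof.
rewrite (big_pred1 x0) // => x /=; apply/esym/eqP/ffunP; by case.
Qed.

Lemma sum_ffunS (V : nmodType) (T : finType) n (F : {ffun 'I_n.+1 -> T} -> V) :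
  \sum_x F x = \sum_t \sum_(x : {ffun 'I_n -> T}) F (fcons t x).
Proof.
rewrite pair_big /= (reindex (fun q : T * {ffun 'I_n -> T} => fcons q.1 q.2)) //=.
exists (fun x : {ffun 'I_n.+1 -> T} => (x ord0, [ffun i => x (lift ord0 i)])).
  move=> [t x] _ /=; rewrite fcons0; congr pair.
  by apply/ffunP => i; rewrite ffunE fconsS.
move=> x _ /=; apply/ffunP => i; rewrite ffunE.
by case: unliftP => [j|] ->; rewrite ?ffunE.
Qed.

Lemma sum_prod_ffun (R : comPzSemiRingType) (T : finType) n (w : 'I_n -> T -> R) :
  \sum_(x : {ffun 'I_n -> T}) \prod_i w i (x i) = \prod_i \sum_t w i t.
Proof. by rewrite bigA_distr_bigA. Qed.

End ProductSums.

Section Convex.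
Variables (R : realType).

Definition convexf (X : lmodType R) (phi : X -> R) :=
  forall (t : R) x y, 0 <= t <= 1 ->
    phi (t *: x + (1 - t) *: y) <= t * phi x + (1 - t) * phi y.

Lemma convexf_normpow (X : normedModType R) (p : R) :
  1 <= p -> convexf (fun x : X => `|x| `^ p).
Proof.
move=> p1 t x y t01; apply: le_trans (powR_convex p1 _ _ t01) => //.
case/andP: t01 => t0 t1; apply: powR_le_mono => //; first lra.
by apply: le_trans (ler_normD _ _) _; rewrite !normrZ !ger0_norm //; lra.
Qed.

Lemma convexf_mid (X : lmodType R) (phi : X -> R) z v : convexf phi ->
  2 * phi z <= phi (z + v) + phi (z - v).
Proof.
move=> /(_ (2^-1) (z + v) (z - v)).
have -> : 1 - 2^-1 = 2^-1 :> R by field.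
rewrite -scalerDr addrACA subrr addr0 -mulr2n -(scaler_nat 2 z) scalerA.
rewrite mulVf ?pnatr_eq0 // scale1r => /(_ ltac:(lra)) H; lra.
Qed.

Lemma convexf_shift_sum (X : lmodType R) (I : finType) (w : I -> R) (u : I -> X)
    (phi : X -> R) : (forall i, 0 <= w i) -> convexf phi ->
  convexf (fun z => \sum_i w i * phi (z + u i)).
Proof.
move=> w0 cphi t x y t01; rewrite !mulr_sumr -big_split /=; apply: ler_sum => i _.
have -> : t *: x + (1 - t) *: y + u i = t *: (x + u i) + (1 - t) *: (y + u i).
  by rewrite !scalerDr addrACA -scalerDl subrKC scale1r.
by apply: le_trans (ler_wpM2l (w0 i) (cphi t _ _ t01)) _; lra.
Qed.

(* Convexity survives averaging over the remaining coordinates, so the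
   one-coordinate comparison may be applied coordinate by coordinate. *)
Lemma convex_order_prod (X : lmodType R) (T T' : finType) n
    (w : 'I_n -> T -> R) (u : 'I_n -> T -> X)
    (w' : 'I_n -> T' -> R) (u' : 'I_n -> T' -> X) :
  (forall i t, 0 <= w i t) -> (forall i t, 0 <= w' i t) ->
  (forall i (phi : X -> R) z, convexf phi ->
     \sum_t w i t * phi (z + u i t) <= \sum_t w' i t * phi (z + u' i t)) ->
  forall (phi : X -> R) z, convexf phi ->
    \sum_(x : {ffun 'I_n -> T}) (\prod_i w i (x i)) * phi (z + \sum_i u i (x i)) <=
    \sum_(x : {ffun 'I_n -> T'}) (\prod_i w' i (x i)) * phi (z + \sum_i u' i (x i)).
Proof.
elim: n w u w' u' => [|n IH] w u w' u' w0 w'0 H phi z cphi.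
  have x0 (S : Type) : {ffun 'I_0 -> S} by apply: finfun; case.
  by rewrite (sum_ffun0 _ (x0 T)) (sum_ffun0 _ (x0 T')) !big_ord0.
rewrite !sum_ffunS.
pose psi y := \sum_(x : {ffun 'I_n -> T'}) (\prod_i w' (lift ord0 i) (x i)) *
                phi (y + \sum_i u' (lift ord0 i) (x i)).
have cpsi : convexf psi.
  by apply: convexf_shift_sum => // x; apply: prodr_ge0.
apply: (@le_trans _ _ (\sum_t w ord0 t * psi (z + u ord0 t))).
  apply: ler_sum => t _.
  have := IH _ _ _ _ (fun i => w0 (lift ord0 i)) (fun i => w'0 (lift ord0 i))
    (fun i => H (lift ord0 i)) phi (z + u ord0 t) cphi.
  move=> /(ler_wpM2l (w0 ord0 t)); rewrite -/(psi _); apply: le_trans.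
  by rewrite mulr_sumr; apply: ler_sum => x _; rewrite !big_fcons -mulrA addrA.
apply: le_trans (H _ _ _ cpsi) _.
apply: ler_sum => t _; rewrite mulr_sumr; apply: ler_sum => x _.
by rewrite !big_fcons -mulrA addrA.
Qed.

Lemma normpow_order_prod (X : normedModType R) (p : R) (T T' : finType) n
    (w : 'I_n -> T -> R) (u : 'I_n -> T -> X)
    (w' : 'I_n -> T' -> R) (u' : 'I_n -> T' -> X) :
  1 <= p -> (forall i t, 0 <= w i t) -> (forall i t, 0 <= w' i t) ->
  (forall i (phi : X -> R) z, convexf phi ->
     \sum_t w i t * phi (z + u i t) <= \sum_t w' i t * phi (z + u' i t)) ->
  \sum_(x : {ffun 'I_n -> T}) (\prod_i w i (x i)) * `|\sum_i u i (x i)| `^ p <=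
  \sum_(x : {ffun 'I_n -> T'}) (\prod_i w' i (x i)) * `|\sum_i u' i (x i)| `^ p.
Proof.
move=> p1 w0 w'0 H; have := convex_order_prod w0 w'0 H 0 (convexf_normpow p1).
under eq_bigr do rewrite add0r.
by under [X in _ <= X -> _]eq_bigr do rewrite add0r.
Qed.

End Convex.

(** * The noise operator and its derivative *)

Section Noise.
Variables (R : realType) (a : R).
Hypothesis a01 : 0 < a < 1.

Definition mu1 (b : bool) : R := if b then a else 1 - a.

Lemma mu1_gt0 b : 0 < mu1 b.
Proof. by case/andP: a01; rewrite /mu1; case: b; lra. Qed.

Lemma sum_mu1 : \sum_b mu1 b = 1.
Proof. by rewrite big_bool /= subrKC. Qed.

Lemma mu_a_ge0 n (x : cube n) : 0 <= mu_a a x.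
Proof. by apply: prodr_ge0 => i _; exact/ltW/mu1_gt0. Qed.

Lemma sum_mu_a n : \sum_(x : cube n) mu_a a x = 1.
Proof.
by rewrite (sum_prod_ffun (fun (i : 'I_n) => mu1)) big1 // => i _; exact: sum_mu1.
Qed.

Definition kern1 (r : R) (b b' : bool) : R :=
  r * (b == b')%:R + (1 - r) * mu1 b'.

(* A polynomial in the noise parameter, so that Taylor's formula is available. *)
Definition kern n (x y : cube n) : {poly R} :=
  \prod_i ((mu1 (y i))%:P + ((x i == y i)%:R - mu1 (y i))%:P * 'X).

Lemma kern_horner n (x y : cube n) r :
  (kern x y).[r] = \prod_i kern1 r (x i) (y i).
Proof.
by rewrite horner_prod; apply: eq_bigr => i _; rewrite !hornerE /kern1; ring.
Qed.

Lemma kern1_ge0 r b b' : 0 <= r <= 1 -> 0 <= kern1 r b b'.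
Proof.
move=> /andP[r0 r1]; have := mu1_gt0 b'; rewrite /kern1 => m0.
by apply: addr_ge0; apply: mulr_ge0 => //; lra.
Qed.

Lemma kern_ge0 n (x y : cube n) r : 0 <= r <= 1 -> 0 <= (kern x y).[r].
Proof. by move=> r01; rewrite kern_horner; apply: prodr_ge0 => i _; exact: kern1_ge0. Qed.

Lemma sum_kern1 r b : \sum_b' kern1 r b b' = 1.
Proof. by rewrite big_bool /kern1 /mu1; case: b => /=; ring. Qed.

Lemma sum_kern n (x : cube n) r : \sum_y (kern x y).[r] = 1.
Proof.
under eq_bigr do rewrite kern_horner.
by rewrite (sum_prod_ffun (fun i => kern1 r (x i))) big1 // => i _; exact: sum_kern1.
Qed.

(** Detailed balance, coordinate by coordinate; it allows the roles of [x] and [y] to be exchanged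
    under the stationary measure. *)
Lemma kern_reversible n (x y : cube n) r :
  mu_a a x * (kern x y).[r] = mu_a a y * (kern y x).[r].
Proof.
rewrite !kern_horner -!big_split; apply: eq_bigr => i _ /=.
by rewrite /kern1 /mu1; case: (x i); case: (y i) => /=; ring.
Qed.

Lemma deriv_prod n (F : 'I_n -> {poly R}) :
  (\prod_i F i)^`() = \sum_i (F i)^`() * \prod_(j | j != i) F j.
Proof.
elim: n F => [|n IH] F; first by rewrite !big_ord0 derivC.
rewrite !big_ord_recl derivM IH; congr (_ + _).
  rewrite [in RHS]big_mkcond big_ord_recl /= mul1r; congr (_ * _).
rewrite mulr_sumr; apply: eq_bigr => i _; rewrite mulrCA; congr (_ * _).
rewrite [in RHS]big_mkcond big_ord_recl /=; congr (_ * _).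
by rewrite big_mkcond; apply: eq_bigr => j _; rewrite (inj_eq lift_inj).
Qed.

Lemma deriv_kern_horner n (x y : cube n) r :
  (kern x y)^`().[r] = \sum_i ((x i == y i)%:R - mu1 (y i)) *
                         \prod_(j | j != i) kern1 r (x j) (y j).
Proof.
rewrite deriv_prod horner_sum; apply: eq_bigr => i _.
rewrite hornerM derivD derivM !derivC derivX mul0r !add0r mulr1 hornerC; congr (_ * _).
by rewrite horner_prod; apply: eq_bigr => j _; rewrite !hornerE /kern1; ring.
Qed.

Variable X : normedModType R.

Definition noise r n (f : cube n -> X) x := \sum_y (kern x y).[r] *: f y.
Definition dnoise r n (f : cube n -> X) x := \sum_y (kern x y)^`().[r] *: f y.

Lemma noise0 n (f : cube n -> X) x : noise 0 f x = expect a f.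
Proof.
apply: eq_bigr => y _; congr (_ *: _); rewrite kern_horner.
by apply: eq_bigr => i _; rewrite /kern1 mul0r add0r subr0 mul1r.
Qed.

Lemma noise1 n (f : cube n -> X) x : noise 1 f x = f x.
Proof.
rewrite /noise (bigD1 x) //= big1 => [|y yx].
  rewrite addr0 kern_horner big1 ?scale1r // => i _.
  by rewrite /kern1 eqxx subrr mul0r addr0 mulr1.
rewrite kern_horner; have [i xyi] : exists i, x i != y i.
  apply/existsP; rewrite -negb_forall; apply: contra yx => /forallP xy.
  by apply/eqP/ffunP => i; rewrite (eqP (xy i)).
by rewrite (bigD1 i) //= /kern1 (negPf xyi) subrr mulr0 mul0r addr0 mul0r scale0r.
Qed.

Lemma upd_upd n (x : cube n) i b b' : upd (upd x i b) i b' = upd x i b'.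
Proof. by apply/ffunP => j; rewrite !ffunE; case: (j == i). Qed.

Lemma updE n (x : cube n) i b : upd x i b i = b.
Proof. by rewrite ffunE eqxx. Qed.

Lemma updN n (x : cube n) i j b : j != i -> upd x i b j = x j.
Proof. by rewrite ffunE => /negPf ->. Qed.

(** Flipping coordinate [i] is an involution, so the sum may be added to its flipped copy; each term
    then contains both neighbours in direction [i]. *)
Lemma sum_upd n (i : 'I_n) (H : cube n -> X) :
  (\sum_y H y) *+ 2 = \sum_y (H (upd y i true) + H (upd y i false)).
Proof.
have fK : involutive (fun y : cube n => upd y i (~~ y i)).
  move=> y; rewrite upd_upd updE negbK; apply/ffunP => j.
  by rewrite ffunE; case: eqP => [->|].
rewrite mulr2n {2}(reindex_inj (inv_inj fK)) -big_split /=.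
apply: eq_bigr => y _; have yE : y = upd y i (y i).
  by apply/ffunP => j; rewrite ffunE; case: eqP => [->|].
by rewrite {1}yE; case: (y i) => //=; rewrite addrC.
Qed.

Lemma eq_sum_upd n (i : 'I_n) (H H' : cube n -> X) :
  (forall y, H (upd y i true) + H (upd y i false) =
             H' (upd y i true) + H' (upd y i false)) ->
  \sum_y H y = \sum_y H' y.
Proof.
move=> HH; apply: (@scalerI _ _ (2 : R)); first by rewrite pnatr_eq0.
by rewrite !scaler_nat !(sum_upd i); apply: eq_bigr => y _; exact: HH.
Qed.

(* Adding a multiple of the stationary measure to the one-coordinate kernel is
   invisible to [dpart], hence the freedom in [c]. *)
Lemma dnoise_repr r (e : bool -> bool -> R) (c : bool -> R) n (f : cube n -> X) x :
  (forall b b', kern1 r b b' * e b b' = (b == b')%:R - mu1 b' + c b * mu1 b') ->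
  dnoise r f x =
  \sum_y (kern x y).[r] *: \sum_i e (x i) (y i) *: dpart a f i y.
Proof.
move=> He; rewrite /dnoise.
under eq_bigr do rewrite deriv_kern_horner scaler_suml.
under [RHS]eq_bigr do rewrite scaler_sumr.
rewrite exchange_big [RHS]exchange_big; apply: eq_bigr => i _ /=.
(* For fixed [i] only two neighbours in direction [i] are compared; the other coordinates give a
   common factor [W]. *)
apply: (eq_sum_upd (i := i)) => y.
pose W := \prod_(j | j != i) kern1 r (x j) (y j).
have WE b : \prod_(j | j != i) kern1 r (x j) (upd y i b j) = W.
  by apply: eq_bigr => j ji; rewrite updN.
have KE b : (kern x (upd y i b)).[r] = kern1 r (x i) b * W.
  by rewrite kern_horner (bigD1 i) //= updE WE.
rewrite !WE !KE !updE /dpart !upd_upd.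
set A := f _; set B := f (upd y i false).
rewrite !scalerA ![kern1 _ _ _ * W * _]mulrAC !He /=.
(* The two values of [dpart] are [1 - a] and [- a] times [A - B], so the contributions of [c],
   namely [c a (1 - a)] with opposite signs, cancel. *)
have -> : A - a *: A - (1 - a) *: B = (1 - a) *: (A - B).
  by rewrite -[X in X - a *: A]scale1r -scalerBl scalerBr.
have -> : B - a *: A - (1 - a) *: B = (- a) *: (A - B).
  by rewrite addrAC -[X in X - (1 - a) *: B]scale1r -scalerBl subKr scalerBr !scaleNr opprK addrC.
rewrite !scalerA -scalerDl.
transitivity ((((x i == true)%:R - mu1 true) * W) *: (A - B)).
  rewrite scalerBr; congr (_ + _); rewrite -scaleNr; congr (_ *: _).
  by rewrite /mu1; case: (x i) => /=; ring.
by congr (_ *: _); rewrite /mu1; case: (x i) => /=; ring.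
Qed.

(** Jensen over [y], then reversibility. Afterwards [y] is frozen: the vectors [dpart a f i y] are
    constants and the weights [e (x i) (y i)] are independent over [i], as convex ordering on
    products requires. *)
Lemma sum_dnoise_le r p (e : bool -> bool -> R) (c : bool -> R) n (f : cube n -> X) :
  1 <= p -> 0 <= r <= 1 ->
  (forall b b', kern1 r b b' * e b b' = (b == b')%:R - mu1 b' + c b * mu1 b') ->
  \sum_(x : cube n) mu_a a x * `|dnoise r f x| `^ p <=
  \sum_(y : cube n) mu_a a y * \sum_(x : cube n) (\prod_i kern1 r (y i) (x i)) *
     `|\sum_i e (x i) (y i) *: dpart a f i y| `^ p.
Proof.
move=> p1 r01 He.
apply: (@le_trans _ _ (\sum_(x : cube n) mu_a a x * \sum_(y : cube n) (kern x y).[r] *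
     `|\sum_i e (x i) (y i) *: dpart a f i y| `^ p)).
  apply: ler_sum => x _; apply: ler_wpM2l; first exact: mu_a_ge0.
  rewrite (dnoise_repr _ _ He).
  apply: le_trans (powR_jensen p1 _ _ (sum_kern x r)); [|by move=> y; exact: kern_ge0|by []].
  apply: powR_le_mono => //; first lra.
  apply: le_trans (ler_norm_sum _ _ _) _; apply: ler_sum => y _.
  by rewrite normrZ ger0_norm // kern_ge0.
under eq_bigr do rewrite mulr_sumr.
rewrite exchange_big le_eqVlt; apply/orP; left; apply/eqP; apply: eq_bigr => y _ /=.
rewrite mulr_sumr; apply: eq_bigr => x _.
by rewrite [LHS]mulrA [RHS]mulrA -kern_horner (kern_reversible x y r).
Qed.

End Noise.

(** * Rademacher averages and random selection *)

Section Rademacher.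
Variables (R : realType) (X : normedModType R).

Definition rad_avg (p : R) n (v : 'I_n -> X) : R :=
  \sum_(d : cube n) sigma_n R d * `|\sum_i sgn R (d i) *: v i| `^ p.

Lemma sigma_n_prod n (d : cube n) : sigma_n R d = \prod_(i < n) 2^-1.
Proof. by rewrite prodr_const card_ord exprVn. Qed.

Lemma sigma_n_ge0 n (d : cube n) : 0 <= sigma_n R d.
Proof. by rewrite invr_ge0 exprn_ge0. Qed.

Lemma sum_sigma_n n : \sum_(d : cube n) sigma_n R d = 1.
Proof.
under eq_bigr do rewrite sigma_n_prod.
rewrite (sum_prod_ffun (fun (i : 'I_n) (b : bool) => 2^-1 : R)) big1 // => i _.
by rewrite big_bool /=; field.
Qed.

Lemma rad_avg_ge0 p n (v : 'I_n -> X) : 0 <= rad_avg p v.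
Proof. by apply: sumr_ge0 => d _; rewrite mulr_ge0 ?sigma_n_ge0 ?powR_ge0. Qed.

(** Convex domination of a centred two-valued variable by one equal to 0 with weight [1 - lam] and
    to [M] or [- M] with weight [lam / 2] each. Each value is interpolated between 0 and [M] or
    [- M]. *)
Lemma convex_two_point (phi : X -> R) z v (q th b L M lam : R) :
  convexf phi -> 0 < M -> 0 <= b <= M -> 0 <= L <= M -> 0 <= q -> 0 <= th ->
  q + th = 1 -> q * b = th * L -> 2 * (th * L) <= lam * M ->
  q * phi (z + b *: v) + th * phi (z - L *: v) <=
  (1 - lam) * phi z + lam / 2 * (phi (z + M *: v) + phi (z - M *: v)).
Proof.
move=> cphi M0 /andP[b0 bM] /andP[L0 LM] q0 th0 q1 qb Hlam.
set A := phi (z + M *: v); set B := phi (z - M *: v); set C := phi z.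
have mid : 2 * C <= A + B by exact: convexf_mid.
have side (s y : R) : 0 <= y <= M ->
    phi (z + (s * y) *: v) <= y / M * phi (z + (s * M) *: v) + (1 - y / M) * C.
  move=> /andP[y0 yM].
  have := cphi (y / M) (z + (s * M) *: v) z.
  have -> : (y / M) *: (z + (s * M) *: v) + (1 - y / M) *: z = z + (s * y) *: v.
    rewrite scalerDr addrAC -scalerDl subrKC scale1r scalerA; congr (_ + _ *: _).
    by field; rewrite gt_eqF.
  apply; apply/andP; split; first by apply: divr_ge0; lra.
  by rewrite ler_pdivrMr // mul1r.
have := side 1 b; rewrite !mul1r b0 bM -/A => /(_ isT)/(ler_wpM2l q0) Hb.
have := side (-1) L; rewrite !mulN1r !scaleNr L0 LM -/B => /(_ isT)/(ler_wpM2l th0) HL.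
(* Centring makes both endpoints receive the same mass [kap], at most [lam / 2]; midpoint convexity
   pays for raising it to [lam / 2]. *)
set kap := th * L / M.
have E1 : q * (b / M) = kap by rewrite mulrA qb.
have E2 : th * (L / M) = kap by rewrite mulrA.
have kl : 2 * kap <= lam by rewrite /kap mulrA ler_pdivrMr.
have Hb' : q * phi (z + b *: v) <= kap * A + (q - kap) * C by rewrite -E1; lra.
have HL' : th * phi (z - L *: v) <= kap * B + (th - kap) * C by rewrite -E2; lra.
have : 0 <= (lam / 2 - kap) * (A + B - 2 * C) by apply: mulr_ge0; lra.
have -> : th = 1 - q by lra.
move: HL'; have -> : th = 1 - q by lra.
nra.
Qed.

(** Here [w k] plays the sum of the signed vectors of colour [k]: an average class carries at most
    the fraction [c] of the p-th moment of the Rademacher sum. *)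
Definition spread (p : R) m (c : R) := forall w : 'I_m -> X,
  m%:R^-1 * \sum_k `|w k| `^ p <= c * rad_avg p w.

Lemma sum_color (V : nmodType) m (F : 'I_m * bool -> V) :
  \sum_t F t = \sum_k (F (k, true) + F (k, false)).
Proof.
rewrite (eq_bigr (fun t => F (t.1, t.2))); last by case.
by rewrite -(pair_bigA _ (fun k s => F (k, s))); apply: eq_bigr => k _; rewrite big_bool.
Qed.

(* Colour the coordinates uniformly with m colours: each colour class is a
   Bernoulli(1/m) selection, and the average over the classes is controlled by
   the property [spread]. *)
Lemma rad_select p m (c M : R) n (v : 'I_n -> X) (T : finType)
    (w : 'I_n -> T -> R) (u : 'I_n -> T -> X) :
  1 <= p -> (0 < m)%N -> 0 <= c -> 0 <= M -> spread p m c ->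
  (forall i t, 0 <= w i t) ->
  (forall i (phi : X -> R) z, convexf phi -> \sum_t w i t * phi (z + u i t) <=
     (1 - m%:R^-1) * phi z +
     m%:R^-1 / 2 * (phi (z + M *: v i) + phi (z - M *: v i))) ->
  \sum_(x : {ffun 'I_n -> T}) (\prod_i w i (x i)) * `|\sum_i u i (x i)| `^ p <=
  M `^ p * c * rad_avg p v.
Proof.
move=> p1 m0 c0 M0 sp w0 H.
have mR : 0 < m%:R :> R by rewrite ltr0n.
have mN : m%:R != 0 :> R by rewrite gt_eqF.
pose om (i : 'I_n) (t : 'I_m * bool) : R := (2 * m%:R)^-1.
have om0 i t : 0 <= om i t by rewrite /om invr_ge0 mulr_ge0 // ltW.
pose wk (x : {ffun 'I_n -> 'I_m * bool}) k : X :=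
  \sum_i (if (x i).1 == k then (sgn R (x i).2 * M) *: v i else 0).
set lhs := \sum_(x : {ffun _}) _.
(* A uniform pair (colour, sign) has colour [k] with probability [1 / m], so class [k] realises
   exactly the selection that dominates [u]. *)
have step k : lhs <= \sum_(x : {ffun 'I_n -> 'I_m * bool})
    (\prod_i om i (x i)) * `|wk x k| `^ p.
  apply: (normpow_order_prod (u' := fun i t =>
    if t.1 == k then (sgn R t.2 * M) *: v i else 0) p1 w0 om0).
  move=> i phi z cphi; apply: le_trans (H i phi z cphi) _.
  rewrite sum_color (bigD1 k) //= eqxx /om !mul1r !mulN1r !scaleNr.
  under eq_bigr => j jk do rewrite (negPf jk) addr0 -mulrDl.
  rewrite sumr_const cardC1 card_ord -[X in _ <= _ + X]mulr_natl.
  have -> : (m.-1%:R = m%:R - 1 :> R) by rewrite -subn1 natrB.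
  by rewrite le_eqVlt; apply/orP; left; apply/eqP; field.
have avg : lhs <= \sum_(x : {ffun 'I_n -> 'I_m * bool})
    (\prod_i om i (x i)) * (c * rad_avg p (wk x)).
  have -> : lhs = m%:R^-1 * \sum_(k < m) lhs.
    by rewrite sumr_const card_ord -[lhs *+ m]mulr_natl mulKf.
  apply: (@le_trans _ _ (m%:R^-1 * \sum_(k < m) \sum_(x : {ffun 'I_n -> 'I_m * bool})
    (\prod_i om i (x i)) * `|wk x k| `^ p)).
    apply: ler_wpM2l; first by rewrite invr_ge0 ltW.
    by apply: ler_sum => k _; exact: step.
  rewrite exchange_big mulr_sumr; apply: ler_sum => x _ /=.
  rewrite -mulr_sumr mulrCA; apply: ler_wpM2l; first by apply: prodr_ge0.
  exact: sp.
apply: le_trans avg _; rewrite /rad_avg.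
under eq_bigr do rewrite mulrCA mulr_sumr.
rewrite -mulr_sumr exchange_big [M `^ p * c]mulrC -mulrA; apply: ler_wpM2l => //=.
(* A dummy average over signs [d] of the colours, to match the one produced by [spread]. *)
have -> : M `^ p * \sum_(d : cube n) sigma_n R d * `|\sum_i sgn R (d i) *: v i| `^ p
  = \sum_(d : cube m) sigma_n R d *
     (\sum_(d : cube n) sigma_n R d * `|\sum_i (sgn R (d i) * M) *: v i| `^ p).
  rewrite -mulr_suml sum_sigma_n mul1r mulr_sumr; apply: eq_bigr => d _.
  rewrite mulrCA; congr (_ * _); rewrite -{1}(ger0_norm M0) -powRM //.
  rewrite -normrZ scaler_sumr; congr (`| _ | `^ _); apply: eq_bigr => i _.
  by rewrite scalerA mulrC.
apply: ler_sum => d _.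
under eq_bigr do rewrite mulrCA.
rewrite -mulr_sumr; apply: ler_wpM2l; first exact: sigma_n_ge0.
under [leRHS]eq_bigr do rewrite sigma_n_prod.
(* For fixed [d], multiplying each coordinate's sign by the sign of its colour leaves it uniform;
   the colours therefore disappear from the law. *)
have H2 := @normpow_order_prod R X p ('I_m * bool)%type bool n om
  (fun i t => (sgn R (d t.1) * sgn R t.2 * M) *: v i) (fun _ _ => 2^-1)
  (fun i s => (sgn R s * M) *: v i) p1 om0.
apply: le_trans (H2 _ _); last 2 first.
- by move=> *; rewrite invr_ge0.
- move=> i phi z _.
  rewrite sum_color big_bool /= /om !mul1r !mulN1r !scaleNr.
  rewrite (eq_bigr (fun=> (2 * m%:R)^-1 * (phi (z + M *: v i) + phi (z - M *: v i)))).
    rewrite sumr_const card_ord -[X in X <= _]mulr_natl le_eqVlt.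
    by apply/orP; left; apply/eqP; field.
  move=> k _; rewrite -mulrDr; congr (_ * _).
  by case: (d k); rewrite /= !(mulN1r, mul1r, mulr1, mulrN, opprK, scaleNr) // addrC.
rewrite le_eqVlt; apply/orP; left; apply/eqP; apply: eq_bigr => x _.
congr (_ * `| _ | `^ _); rewrite /wk.
under eq_bigr do rewrite scaler_sumr.
rewrite exchange_big; apply: eq_bigr => i _ /=.
rewrite (bigD1 (x i).1) //= eqxx scalerA mulrA big1 ?addr0 // => k kx.
by rewrite eq_sym (negPf kx) scaler0.
Qed.

End Rademacher.

(** * Bounds on the derivative of the noise operator *)

Section RademacherBounds.
Variables (R : realType) (X : normedModType R).

(** Start from the sum with only coordinate [i] present; inserting a random sign at any other
    coordinate raises convex averages by midpoint convexity. *)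
Lemma normpow_le_rad p n (v : 'I_n -> X) i : 1 <= p -> `|v i| `^ p <= rad_avg p v.
Proof.
move=> p1; have H := @normpow_order_prod R X p bool bool n (fun _ _ => 2^-1)
  (fun j b => if j == i then sgn R b *: v i else 0) (fun _ _ => 2^-1)
  (fun j b => sgn R b *: v j) p1.
rewrite /rad_avg; under eq_bigr do rewrite sigma_n_prod.
apply: le_trans (H _ _ _); last 3 first.
- by move=> *; rewrite invr_ge0.
- by move=> *; rewrite invr_ge0.
- move=> j phi z cphi; rewrite !big_bool /= !scale1r !scaleN1r.
  case: eqP => [->//|_]; rewrite addr0.
  by have := convexf_mid z (v j) cphi; clear; lra.
rewrite (eq_bigr (fun x : cube n => sigma_n R x * `|v i| `^ p)).
  by rewrite -mulr_suml sum_sigma_n mul1r.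
move=> x _; rewrite sigma_n_prod; congr (_ * _ `^ _).
rewrite (bigD1 i) //= eqxx big1 ?addr0 => [|j /negPf -> //].
by rewrite normrZ; case: (x i); rewrite /= ?normrN normr1 mul1r.
Qed.

Lemma spread1 p : 1 <= p -> spread X p 1 1.
Proof.
by move=> p1 w; rewrite big_ord1 invr1 !mul1r; exact: normpow_le_rad.
Qed.

End RademacherBounds.

(** * L_p norms on the biased cube and the two derivative bounds *)

Section Lp.
Variables (R : realType) (a p : R).
Hypotheses (a01 : 0 < a < 1) (p1 : 1 <= p).
Variable X : normedModType R.

Let p0 : 0 < p. Proof. by move: p1; lra. Qed.

Lemma Lpnorm_ge0 n (g : cube n -> X) : 0 <= Lpnorm a p g.
Proof. exact: powR_ge0. Qed.

Lemma Lpnorm_powE n (g : cube n -> X) :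
  Lpnorm a p g `^ p = \sum_x mu_a a x * `|g x| `^ p.
Proof.
rewrite /Lpnorm powRVK //; apply: sumr_ge0 => x _.
by rewrite mulr_ge0 ?mu_a_ge0 ?powR_ge0.
Qed.

Lemma Lpnorm_le n (g : cube n -> X) c : 0 <= c ->
  (Lpnorm a p g <= c) = (\sum_x mu_a a x * `|g x| `^ p <= c `^ p).
Proof.
move=> c0; rewrite /Lpnorm powR_rootP //; apply: sumr_ge0 => x _.
by rewrite mulr_ge0 ?mu_a_ge0 ?powR_ge0.
Qed.

Lemma Lpnorm_triangle n (f g h : cube n -> X) A B :
  (forall x, `|f x| <= `|g x| + `|h x|) ->
  Lpnorm a p g <= A -> Lpnorm a p h <= B -> Lpnorm a p f <= A + B.
Proof.
move=> fgh gA hB.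
have A0 : 0 <= A by apply: le_trans gA; exact: Lpnorm_ge0.
have B0 : 0 <= B by apply: le_trans hB; exact: Lpnorm_ge0.
rewrite Lpnorm_le ?addr_ge0 //.
rewrite Lpnorm_le // in gA; rewrite Lpnorm_le // in hB.
apply: le_trans _ (powR_minkowski p1 (mu_a_ge0 a01 (n := n)) _ _ A0 B0 gA hB) => //.
apply: ler_sum => x _; apply: ler_wpM2l; first exact: mu_a_ge0.
by apply: powR_le_mono => //; exact: ltW.
Qed.

Lemma Lpnorm_scale n (f g : cube n -> X) s A : 0 <= s ->
  (forall x, `|f x| = s * `|g x|) -> Lpnorm a p g <= A -> Lpnorm a p f <= s * A.
Proof.
move=> s0 fg gA; have A0 : 0 <= A by apply: le_trans gA; exact: Lpnorm_ge0.
rewrite Lpnorm_le ?mulr_ge0 // powRM //.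
rewrite Lpnorm_le // in gA.
under eq_bigr do rewrite fg powRM // mulrCA.
by rewrite -mulr_sumr; apply: ler_wpM2l => //; exact: powR_ge0.
Qed.

Lemma Lpnorm_sup n (f : cube n -> X) A : 0 <= A -> (forall x, `|f x| <= A) ->
  Lpnorm a p f <= A.
Proof.
move=> A0 fA; rewrite Lpnorm_le //.
rewrite -[leRHS]mul1r -(sum_mu_a a n) mulr_suml; apply: ler_sum => x _.
by apply: ler_wpM2l; [exact: mu_a_ge0|apply: powR_le_mono => //; exact: ltW].
Qed.

Lemma rhs_avg_ge0 n (f : cube n -> X) : 0 <= rhs_avg a p f.
Proof. exact: powR_ge0. Qed.

(** Fubini: with the point [y] outermost, Rademacher averages can be estimated pointwise. *)
Lemma rhs_avg_powE n (f : cube n -> X) :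
  rhs_avg a p f `^ p = \sum_y mu_a a y * rad_avg p (fun i => dpart a f i y).
Proof.
rewrite /rhs_avg powRVK //; last first.
  by apply: sumr_ge0 => d _; rewrite mulr_ge0 ?sigma_n_ge0 ?powR_ge0.
under eq_bigr do rewrite Lpnorm_powE mulr_sumr.
rewrite exchange_big; apply: eq_bigr => y _ /=; rewrite /rad_avg mulr_sumr.
by apply: eq_bigr => d _; rewrite mulrCA.
Qed.

(** The freedom in [c] permits the constant weight [e = 1 / r], which stays bounded as [r] tends to
    1. Each of the [n] derivatives is then bounded separately by the Rademacher average. *)
Lemma Lpnorm_dnoise_near1 r n (f : cube n -> X) : 0 < r <= 1 ->
  Lpnorm a p (dnoise a r f) <= r^-1 * n%:R * rhs_avg a p f.
Proof.
move=> /andP[r0 r1].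
have rn0 : 0 <= r^-1 * n%:R by rewrite mulr_ge0 ?invr_ge0 // ltW.
have rh0 := rhs_avg_ge0 f.
rewrite Lpnorm_le; last exact: mulr_ge0.
rewrite powRM // rhs_avg_powE.
have r01 : 0 <= r <= 1 by rewrite ltW.
apply: le_trans (@sum_dnoise_le _ _ a01 X r p (fun _ _ => r^-1) (fun=> r^-1) n f p1 r01 _) _.
  by move=> b b'; rewrite /kern1; field; rewrite gt_eqF.
rewrite mulr_sumr; apply: ler_sum => y _; rewrite mulrCA.
apply: ler_wpM2l; first exact: mu_a_ge0.
rewrite -mulr_suml (sum_prod_ffun (fun i => kern1 a r (y i))) big1 ?mul1r => [|i _];
  last exact: sum_kern1.
set v := fun i => dpart a f i y; have rv0 := rad_avg_ge0 p v.
rewrite -(powRVK p0 rv0) -powRM ?powR_ge0 //; apply: powR_le_mono => //; first exact: ltW.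
rewrite -scaler_sumr normrZ ger0_norm ?invr_ge0 ?(ltW r0) // -mulrA.
apply: ler_wpM2l; first by rewrite invr_ge0 ltW.
apply: le_trans (ler_norm_sum _ _ _) _.
rewrite -[n in n%:R]card_ord mulr_natl -sumr_const; apply: ler_sum => i _.
rewrite -(powRK p0 (normr_ge0 _)); apply: powR_le_mono; rewrite ?powR_ge0 ?invr_ge0 ?(ltW p0) //.
exact: (normpow_le_rad v).
Qed.

(* The kernel weight [e] is mean zero given [b'], with two values: a bounded
   one and [- (1 - r)^-1], the latter of probability at most [1 - r]. *)
Lemma Lpnorm_dnoise_spread r m (c M : R) n (f : cube n -> X) :
  0 <= r < 1 -> (0 < m)%N -> 0 <= c -> spread X p m c ->
  a^-1 <= M -> (1 - a)^-1 <= M -> (1 - r)^-1 <= M ->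
  m = 1 \/ 2 * (1 - r) <= m%:R^-1 ->
  Lpnorm a p (dnoise a r f) <= M * c `^ p^-1 * rhs_avg a p f.
Proof.
move=> /andP[r0 r1] m0 c0 sp Ma M1a Mr mr.
case/andP: (a01) => a0 a1.
have M0 : 0 < M by apply: lt_le_trans Ma; rewrite invr_gt0.
have rh0 := rhs_avg_ge0 f; have M0' := ltW M0.
have cp0 : 0 <= c `^ p^-1 by exact: powR_ge0.
have Mcp0 : 0 <= M * c `^ p^-1 by exact: mulr_ge0.
rewrite Lpnorm_le; last exact: mulr_ge0.
rewrite !powRM // rhs_avg_powE powRVK //.
have k0 b b' : 0 < kern1 a r b b'.
  have := mu1_gt0 a01 b'; rewrite /kern1 => m1.
  have [->|r_neq0] := eqVneq r 0; first by lra.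
  have {}r_neq0 : 0 < r by rewrite lt_neqAle eq_sym r_neq0.
  have : 0 < (1 - r) * mu1 a b' by apply: mulr_gt0 => //; lra.
  by case: (b == b') => /=; lra.
pose e b b' := ((b == b')%:R - mu1 a b') / kern1 a r b b'.
have r01 : 0 <= r <= 1 by rewrite r0 ltW.
apply: le_trans (@sum_dnoise_le _ _ a01 X r p e (fun=> 0) n f p1 r01 _) _.
  by move=> b b'; rewrite /e mul0r addr0 mulrC divfK // gt_eqF.
rewrite mulr_sumr; apply: ler_sum => y _; rewrite [leRHS]mulrCA.
apply: ler_wpM2l; first exact: mu_a_ge0.
apply: (rad_select (m := m) (c := c) (v := fun i => dpart a f i y) (w := fun i => kern1 a r (y i))
  (u := fun i b => e b (y i) *: dpart a f i y)) => //.
  by move=> i t; exact: ltW.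
move=> i phi z cphi; set v := dpart a f i y; set b0 := y i.
set mu := mu1 a b0; have mu0 : 0 < mu by exact: mu1_gt0.
have mu_lt1 : mu < 1 by rewrite /mu /mu1; case: (b0); lra.
have muM : mu^-1 <= M by rewrite /mu /mu1; case: (b0).
(* Given [b0], the weight [e] takes the value [(1 - mu) / q] with probability [q] and [- L] with
   probability [th]; [thL] expresses centring. *)
set q := r + (1 - r) * mu.
have q0 : 0 < q by have := k0 b0 b0; rewrite /kern1 eqxx mulr1.
have muq : mu <= q by rewrite /q; nra.
set th := (1 - r) * (1 - mu).
have th0 : 0 <= th by apply: mulr_ge0; lra.
have qth : q + th = 1 by rewrite /q /th; ring.
set L := (1 - r)^-1; have rn : 0 < 1 - r by lra.
have thL : th * L = 1 - mu by rewrite /th /L; field; rewrite gt_eqF.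
have b0e : e b0 b0 = (1 - mu) / q by rewrite /e /kern1 eqxx mulr1.
have LM : 0 <= L <= M by rewrite Mr invr_ge0 ltW.
have bM : 0 <= (1 - mu) / q <= M.
  rewrite divr_ge0 /= ?(ltW q0) ?subr_ge0 ?(ltW mu_lt1) //; apply: le_trans muM.
  rewrite ler_pdivrMr //; apply: (@le_trans _ _ 1); first lra.
  by rewrite mulrC ler_pdivlMr ?mul1r.
(* For [m = 1], centring writes [2 th L] as [q b + th L], an average of values at most [M].
   Otherwise [th <= 1 - r] and the rate condition apply. *)
have main : 2 * (th * L) <= m%:R^-1 * M.
  case: mr => [->|mr].
    have qM : q * ((1 - mu) / q) <= q * M by apply: ler_wpM2l; [exact: ltW|case/andP: bM].
    have thM : th * L <= th * M by exact: ler_wpM2l.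
    rewrite mulrC divfK ?gt_eqF // in qM.
    have EM : M = q * M + th * M by rewrite -mulrDl qth mul1r.
    by rewrite invr1 mul1r; lra.
  apply: (@le_trans _ _ (2 * (1 - r) * M)); last by apply: ler_wpM2r => //; exact: ltW.
  rewrite -mulrA; apply: ler_wpM2l => //; apply: (@le_trans _ _ (th * M)).
    by apply: ler_wpM2l => //.
  apply: ler_wpM2r; first exact: ltW.
  have : 0 < (1 - r) * mu by exact: mulr_gt0.
  by rewrite /th mulrBr mulr1; lra.
have qb : q * ((1 - mu) / q) = th * L by rewrite mulrC divfK ?gt_eqF.
apply: le_trans (convex_two_point z v cphi M0 bM LM (ltW q0) th0 qth qb main).
rewrite -b0e.
have neq b : b != b0 -> kern1 a r b0 b * phi (z + e b b0 *: v) = th * phi (z - L *: v).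
  move=> bb0; rewrite /kern1 /e [b0 == b]eq_sym (negPf bb0) mulr0 !add0r; congr (_ * phi (_ + _)).
    by move: bb0; rewrite /th /mu /mu1; case: (b); case: (b0) => //= _; ring.
  rewrite -scaleNr; congr (_ *: _); rewrite /kern1 (negPf bb0) -/mu /L mulr0 add0r.
  by field; rewrite !gt_eqF.
have eq1 : kern1 a r b0 b0 = q by rewrite /kern1 eqxx mulr1.
rewrite (bigD1 b0) //= eq1 lerD2l (bigD1 (~~ b0)) /=; last by case: (b0).
rewrite big1 ?addr0 => [|b]; last by case: (b); case: (b0).
by rewrite neq //; case: (b0).
Qed.

End Lp.

(** * Mean value inequality *)

Section MeanValue.
Variables (R : realType) (a p : R).
Hypotheses (a01 : 0 < a < 1) (p1 : 1 <= p).
Variable X : normedModType R.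

(** The Taylor expansion is finite, its coefficients at [x] are bounded on [0, 1], and [h ^ i <= 1].
    Nothing is evaluated at intermediate points, so [x + h] may exceed 1. *)
Lemma poly_taylor1_bound (P : {poly R}) : exists2 D : R, 0 <= D &
  forall x h, 0 <= x <= 1 -> 0 <= h <= 1 ->
    `|P.[x + h] - P.[x] - h * P^`().[x]| <= D * h ^+ 2.
Proof.
pose ub (i : nat) : R := sval (poly_itv_bound P^`N(i.+2) 0 1).
have ubP i x : 0 <= x <= 1 -> `|P^`N(i.+2).[x]| <= ub i.
  by rewrite /ub; case: poly_itv_bound => u /= H /H.
have ub0 i : 0 <= ub i by apply: le_trans (ubP i 0 _); rewrite ?lexx ?ler01.
exists (\sum_(i < size P) ub i); first by apply: sumr_ge0.
move=> x h x01 /andP[h0 h1].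
(* Padding to [(size P).+2] terms lets two be split off whatever the degree. *)
rewrite (@nderiv_taylor_wide _ (size P).+2) ?leqW //; last exact: mulrC.
rewrite !big_ord_recl /= nderivn0 nderivn1; set S := \sum_(i < _) _.
have -> : P.[x] * h ^+ 0 + (P^`().[x] * h ^+ 1 + S) - P.[x] - h * P^`().[x] = S by ring.
apply: le_trans (ler_norm_sum _ _ _) _; rewrite mulr_suml; apply: ler_sum => i _.
rewrite normrM; apply: ler_pM => //; first exact: ubP.
by rewrite normrX ger0_norm // (exprD h 2 i) ler_piMr ?exprn_ge0 // exprn_ile1.
Qed.

Lemma noise_taylor n (f : cube n -> X) : exists2 D : R, 0 <= D &
  forall r h x, 0 <= r <= 1 -> 0 <= h <= 1 ->
    `|noise a (r + h) f x - noise a r f x - h *: dnoise a r f x| <= D * h ^+ 2.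
Proof.
pose D (x y : cube n) := s2val (cid2 (poly_taylor1_bound (kern a x y))).
have D0 x y : 0 <= D x y by rewrite /D; case: cid2.
have DP x y r h : 0 <= r <= 1 -> 0 <= h <= 1 ->
    `|(kern a x y).[r + h] - (kern a x y).[r] - h * (kern a x y)^`().[r]|
      <= D x y * h ^+ 2 by rewrite /D; case: cid2 => d /= _; exact.
exists (\sum_x \sum_y D x y * `|f y|).
  by apply: sumr_ge0 => x _; apply: sumr_ge0 => y _; exact: mulr_ge0.
move=> r h x r01 h01; rewrite /noise /dnoise scaler_sumr -!sumrB.
apply: le_trans (ler_norm_sum _ _ _) _; rewrite mulr_suml [leRHS](bigD1 x) //=.
apply: ler_wpDr.
  apply: sumr_ge0 => z _; rewrite mulr_ge0 ?exprn_ge0 //; last by case/andP: h01.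
  by apply: sumr_ge0 => y _; exact: mulr_ge0.
rewrite mulr_suml; apply: ler_sum => y _.
rewrite scalerA -!scalerBl normrZ mulrAC; apply: ler_wpM2r => //; exact: DP.
Qed.

(* Uniform partition of [s, t]: the linear terms add up to [c * (t - s)] and the
   quadratic remainders vanish as the mesh goes to 0. *)
Lemma Lpnorm_noise_mvt (c s t : R) n (f : cube n -> X) : 0 <= s -> s <= t -> t <= 1 ->
  (forall r, s <= r <= t -> Lpnorm a p (dnoise a r f) <= c) ->
  Lpnorm a p (fun x => noise a t f x - noise a s f x) <= (t - s) * c.
Proof.
move=> s0 st t1 H; have [D D0 DP] := noise_taylor f.
have c0 : 0 <= c by apply: le_trans (Lpnorm_ge0 _ _ _) (H s _); rewrite lexx.
apply/ler_addgt0Pr => eps eps0.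
(* The [N] remainders add up to [D (t - s) ^ 2 / N], which this choice makes at most [eps]. *)
pose N := (Num.truncn (D * (t - s) ^+ 2 / eps)).+1.
have N0 : 0 < N%:R :> R by rewrite ltr0n.
have NP : D * (t - s) ^+ 2 / N%:R <= eps.
  by rewrite ler_pdivrMr // [eps * _]mulrC -ler_pdivrMr // ltW // truncnS_gt.
pose h := (t - s) / N%:R.
have h0 : 0 <= h by apply: divr_ge0; [lra|exact: ltW].
have Nh : N%:R * h = t - s by rewrite /h mulrC divfK // gt_eqF.
have step k : (k <= N)%N ->
    Lpnorm a p (fun x => noise a (s + k%:R * h) f x - noise a s f x) <=
    k%:R * (h * c + D * h ^+ 2).
  elim: k => [_|k IH kN].
    by apply: Lpnorm_sup => [//|//||x]; rewrite !mul0r ?addr0 ?subrr ?normr0.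
  have kS z : k.+1%:R * z = k%:R * z + z :> R by rewrite -natr1 mulrDl mul1r.
  set r := s + k%:R * h.
  have kh0 : 0 <= k%:R * h by rewrite mulr_ge0.
  have kh : k%:R * h + h <= t - s.
    by rewrite -Nh -kS ler_wpM2r // ler_nat.
  have r01 : 0 <= r <= 1 by rewrite /r; apply/andP; split; lra.
  have h01 : 0 <= h <= 1 by apply/andP; split; lra.
  have rst : s <= r <= t by rewrite /r; apply/andP; split; lra.
  rewrite [leRHS]kS.
  have hd : Lpnorm a p (fun x => h *: dnoise a r f x) <= h * c.
    apply: (@Lpnorm_scale R a p a01 p1 X n _ (dnoise a r f)) => //; last exact: H.
    by move=> x; rewrite normrZ ger0_norm.
  have rem : Lpnorm a p (fun x => noise a (r + h) f x - noise a r f x - h *: dnoise a r f x)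
      <= D * h ^+ 2.
    by apply: Lpnorm_sup => [//|//||x]; [rewrite mulr_ge0 ?exprn_ge0|exact: DP].
  have Dh : Lpnorm a p (fun x => noise a (r + h) f x - noise a r f x) <= h * c + D * h ^+ 2.
    apply: (Lpnorm_triangle a01 p1 _ hd rem) => x.
    by apply: le_trans (ler_normD _ _); rewrite subrKC.
  apply: (Lpnorm_triangle a01 p1 _ (IH (ltnW kN)) Dh) => x.
  apply: le_trans (ler_normD _ _); rewrite -/r.
  have -> : s + k.+1%:R * h = r + h by rewrite /r kS addrA.
  by rewrite [leRHS](_ : _ = `|noise a (r + h) f x - noise a s f x|) // addrC subrKA.
have := step N (leqnn N); rewrite Nh subrKC => /le_trans; apply.
rewrite mulrDr mulrA Nh lerD2l.
have -> : N%:R * (D * h ^+ 2) = D * (t - s) ^+ 2 / N%:R by rewrite /h; field; rewrite gt_eqF.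
exact: NP.
Qed.

End MeanValue.

(** * Hypercontractivity and Kahane's inequality *)

Section Kahane.
Variables (R : realType) (X : normedModType R).

(** Even and odd parts of [(1 + z) ^ n] are bounded together, since each enters the recursion of the
    other. *)
Lemma expr_even_odd_bound (z : R) n : 0 <= z <= 1 ->
  (1 + z) ^+ n + (1 - z) ^+ n <= 2 * (1 + (2 ^+ n - 1) * z ^+ 2) /\
  0 <= (1 + z) ^+ n - (1 - z) ^+ n <= 2 * 2 ^+ n * z.
Proof.
move=> /andP[z0 z1]; elim: n => [|n [IH1 /andP[IH2 IH3]]].
  by rewrite !expr0; split; [lra|apply/andP; split; lra].
have p2 : 1 <= 2 ^+ n :> R by rewrite exprn_ege1 // ler1n.
move: IH1 IH2 IH3 p2; rewrite !exprS.
set S := (1 + z) ^+ n; set D := (1 - z) ^+ n; set t := 2 ^+ n => IH1 IH2 IH3 p2.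
have E1 : (1 + z) * S + (1 - z) * D = (S + D) + z * (S - D) by ring.
have E2 : (1 + z) * S - (1 - z) * D = (S - D) + z * (S + D) by ring.
have SD0 : 0 <= S + D by apply: addr_ge0; apply: exprn_ge0; lra.
have zSD : 0 <= z * (S + D) by exact: mulr_ge0.
have H1 := ler_wpM2l z0 IH3.
have H2 := ler_wpM2l z0 IH1.
have z2 : z ^+ 2 <= 1 by rewrite expr2; nra.
have z3 : z * ((t - 1) * z ^+ 2) <= z * (t - 1).
  by apply: ler_wpM2l => //; rewrite ler_piMr //; lra.
by rewrite E1 E2; split; [lra|apply/andP; split; lra].
Qed.

(** After division by [u] only the even part remains. The far from sharp factor [2 ^ - N] is chosen
    so that [2 ^ (2 N) rho ^ 2 = 1], which leaves [1 + y ^ 2 <= (1 + y ^ 2) ^ N]. *)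
Lemma two_point_hypercontractive (u w : R) N : (0 < N)%N -> `|w| <= u ->
  (u + 2^-1 ^+ N * w) ^+ N.*2 + (u - 2^-1 ^+ N * w) ^+ N.*2 <=
  2 * (u ^+ 2 + w ^+ 2) ^+ N.
Proof.
move=> N0; wlog w0 : w / 0 <= w => [H wu|].
  have [/H|w0] := leP 0 w; first exact.
  by have := H (- w); rewrite normrN sqrrN mulrN opprK addrC; apply => //; lra.
rewrite ger0_norm // => wu.
have [u0|u_neq0] := eqVneq u 0.
  have -> : w = 0 by lra.
  case: N N0 => // k _; rewrite u0 mulr0 addr0 subr0 doubleS !expr0n /= addr0.
  by rewrite expr0n /= mulr0.
have u0 : 0 < u by rewrite lt_neqAle eq_sym u_neq0; lra.
set rho : R := 2^-1 ^+ N; set y := w / u.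
have wE : w = u * y by rewrite /y mulrC divfK.
have y0 : 0 <= y by apply: divr_ge0 => //; exact: ltW.
have y1 : y <= 1 by rewrite /y ler_pdivrMr // mul1r.
have r0 : 0 <= rho by apply: exprn_ge0; rewrite invr_ge0.
have r1 : rho <= 1 by apply: exprn_ile1; [rewrite invr_ge0|lra].
have z01 : 0 <= rho * y <= 1 by rewrite mulr_ge0 //= mulr_ile1.
have [H _] := expr_even_odd_bound N.*2 z01.
have -> : u + rho * w = u * (1 + rho * y) by rewrite wE; ring.
have -> : u - rho * w = u * (1 - rho * y) by rewrite wE; ring.
have -> : u ^+ 2 + w ^+ 2 = u ^+ 2 * (1 + y ^+ 2) by rewrite wE; ring.
rewrite (exprMn _ (u ^+ 2)) (exprMn _ u (1 + _)) (exprMn _ u (1 - _)) -exprM mul2n.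
rewrite -mulrDr [leRHS]mulrCA; apply: ler_wpM2l.
  by apply: exprn_ge0; exact: ltW.
apply: le_trans H _; apply: ler_wpM2l => //.
have rr : 2 ^+ N.*2 * rho ^+ 2 = 1.
  by rewrite /rho -exprM muln2 -exprMn mulfV ?expr1n // pnatr_eq0.
apply: (@le_trans _ _ (1 + y ^+ 2)).
  have : 0 <= rho ^+ 2 * y ^+ 2 by rewrite mulr_ge0 // exprn_ge0.
  have -> : (2 ^+ N.*2 - 1) * (rho * y) ^+ 2 =
    2 ^+ N.*2 * rho ^+ 2 * y ^+ 2 - rho ^+ 2 * y ^+ 2 by ring.
  by rewrite rr; lra.
have y2 : 1 <= 1 + y ^+ 2 by rewrite lerDl exprn_ge0.
by rewrite ler_eXnr.
Qed.

(** Reduction to scalars: [y + rho v] and [y - rho v] are convex combinations of [y + v] and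
    [y - v], so their norms are at most [u + rho w] and [u - rho w], with [u], [w] the half sum and
    half difference of [A] and [B]. *)
Lemma two_point_norm (y v : X) N : (0 < N)%N ->
  `|y + 2^-1 ^+ N *: v| ^+ N.*2 + `|y - 2^-1 ^+ N *: v| ^+ N.*2 <=
  2 * (2^-1 * `|y + v| ^+ 2 + 2^-1 * `|y - v| ^+ 2) ^+ N.
Proof.
move=> N0; set rho : R := 2^-1 ^+ N.
set A := `|y + v|; set B := `|y - v|.
have r0 : 0 <= rho by apply: exprn_ge0; rewrite invr_ge0.
have r1 : rho <= 1 by apply: exprn_ile1; [rewrite invr_ge0|lra].
have A0 : 0 <= A by exact: normr_ge0.
have B0 : 0 <= B by exact: normr_ge0.
pose u := (A + B) / 2; pose w := (A - B) / 2.
have mix (v' : X) : `|y + rho *: v'| <=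
    (1 + rho) / 2 * `|y + v'| + (1 - rho) / 2 * `|y - v'|.
  have -> : y + rho *: v' = ((1 + rho) / 2) *: (y + v') + ((1 - rho) / 2) *: (y - v').
    rewrite !scalerDr scalerN addrACA -scalerDl -scalerBl.
    by congr (_ + _ *: _); [rewrite -[LHS]scale1r; congr (_ *: _)|]; field.
  apply: le_trans (ler_normD _ _) _; rewrite !normrZ !ger0_norm //; lra.
have up : `|y + rho *: v| <= u + rho * w.
  by apply: le_trans (mix v) _; rewrite -/A -/B /u /w; lra.
have um : `|y - rho *: v| <= u - rho * w.
  have := mix (- v); rewrite scalerN opprK -/A -/B => /le_trans; apply.
  by rewrite /u /w; lra.
have wu : `|w| <= u by rewrite ler_norml /u /w; apply/andP; split; lra.
have := two_point_hypercontractive N0 wu; rewrite -/rho.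
have -> : u ^+ 2 + w ^+ 2 = 2^-1 * A ^+ 2 + 2^-1 * B ^+ 2 by rewrite /u /w; field.
by apply: le_trans; apply: lerD; apply: lerXn2r => //; rewrite nnegrE //;
  apply: le_trans (normr_ge0 _) _; eassumption.
Qed.

(** Induction on coordinates: the two-point inequality treats the first sign, Minkowski with
    exponent [N] splits the result, and the induction hypothesis is used at the shifted base points
    [y + h] and [y - h], which is why [y] is free. *)
Lemma rad_hypercontractive N n (y : X) (v : 'I_n -> X) : (0 < N)%N ->
  \sum_(d : cube n) sigma_n R d *
     `|y + 2^-1 ^+ N *: \sum_i sgn R (d i) *: v i| ^+ N.*2 <=
  (\sum_(d : cube n) sigma_n R d * `|y + \sum_i sgn R (d i) *: v i| ^+ 2) ^+ N.
Proof.
move=> N0; elim: n y v => [|n IH] y v.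
  have x0 : cube 0 by apply: finfun; case.
  rewrite (sum_ffun0 _ x0) (sum_ffun0 _ x0) !big_ord0 scaler0 !addr0.
  by rewrite /sigma_n expr0 invr1 !mul1r -exprM mul2n.
set rho : R := 2^-1 ^+ N.
have sg (b : bool) (x : cube n) : sigma_n R (fcons b x) = 2^-1 * sigma_n R x.
  by rewrite /sigma_n exprS invfM.
set v' := fun i => v (lift ord0 i); set h := v ord0.
pose S (x : cube n) : X := \sum_i sgn R (x i) *: v' i.
have SE b (x : cube n) : \sum_i sgn R (fcons b x i) *: v i = sgn R b *: h + S x.
  by rewrite (big_fcons _ (fun i b => sgn R b *: v i)).
rewrite !sum_ffunS !big_bool /=.
rewrite -!big_split /=.
under eq_bigr do rewrite !sg !SE /= !scale1r !scaleN1r !scalerDr scalerN.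
under [in leRHS]eq_bigr do rewrite !sg !SE /= !scale1r !scaleN1r.
rewrite -/rho.
pose g x := 2^-1 * `|(y + h) + rho *: S x| ^+ 2.
pose g' x := 2^-1 * `|(y - h) + rho *: S x| ^+ 2.
pose A := 2^-1 * \sum_(x : cube n) sigma_n R x * `|(y + h) + S x| ^+ 2.
pose B := 2^-1 * \sum_(x : cube n) sigma_n R x * `|(y - h) + S x| ^+ 2.
have q0 (z : X) : 0 <= \sum_(x : cube n) sigma_n R x * `|z + S x| ^+ 2.
  by apply: sumr_ge0 => x _; rewrite mulr_ge0 ?sigma_n_ge0 ?exprn_ge0.
have h2 : 0 <= 2^-1 :> R by rewrite invr_ge0.
have N1 : 1 <= N%:R :> R by rewrite ler1n.
have IH' (z : X) : \sum_(x : cube n) sigma_n R x * (2^-1 * `|z + rho *: S x| ^+ 2) `^ N%:R <=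
    (2^-1 * \sum_(x : cube n) sigma_n R x * `|z + S x| ^+ 2) `^ N%:R.
  rewrite powR_mulrn ?mulr_ge0 // exprMn.
  under eq_bigr => x _ do
    rewrite powR_mulrn ?mulr_ge0 ?exprn_ge0 // exprMn -exprM mul2n mulrCA.
  by rewrite -mulr_sumr; apply: ler_wpM2l; [exact: exprn_ge0|exact: IH].
have := powR_minkowski N1 (@sigma_n_ge0 R n) _ _ _ _ (IH' (y + h)) (IH' (y - h)).
move=> /(_ ltac:(by move=> x; rewrite mulr_ge0 ?exprn_ge0)).
move=> /(_ ltac:(by move=> x; rewrite mulr_ge0 ?exprn_ge0)).
move=> /(_ ltac:(by rewrite mulr_ge0) ltac:(by rewrite mulr_ge0)).
rewrite powR_mulrn ?addr_ge0 ?mulr_ge0 // => M.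
apply: (le_trans _ (le_trans M _)); last first.
  rewrite -mulrDr -big_split /= mulr_sumr le_eqVlt; apply/orP; left; apply/eqP.
  by congr (_ ^+ _); apply: eq_bigr => x _; rewrite !addrA; ring.
apply: ler_sum => x _.
rewrite powR_mulrn; last by rewrite addr_ge0 ?mulr_ge0 ?exprn_ge0.
have H := ler_wpM2l (sigma_n_ge0 R x) (two_point_norm (y + rho *: S x) h N0).
rewrite -/rho in H.
have -> : y + (rho *: h + rho *: S x) = y + rho *: S x + rho *: h by rewrite addrAC addrA.
have -> : y + (- (rho *: h) + rho *: S x) = y + rho *: S x - rho *: h by rewrite addrAC addrA.
by rewrite ![y + _ + rho *: S x]addrAC; lra.
Qed.

End Kahane.

(** * Comparison of Rademacher moments and the gain from cotype *)

Section CotypeSpread.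
Variables (R : realType) (X : normedModType R).

Let avg n (v : 'I_n -> X) (k : nat) : R :=
  \sum_(d : cube n) sigma_n R d * `|\sum_i sgn R (d i) *: v i| ^+ k.

Let avg_ge0 n (v : 'I_n -> X) k : 0 <= avg v k.
Proof. by apply: sumr_ge0 => d _; rewrite mulr_ge0 ?sigma_n_ge0 ?exprn_ge0. Qed.

Let avg_hyper N n (v : 'I_n -> X) : (0 < N)%N ->
  (2^-1 ^+ N) ^+ N.*2 * avg v N.*2 <= avg v 2 ^+ N.
Proof.
move=> N0; have := rad_hypercontractive 0 v N0.
under eq_bigr do rewrite add0r normrZ exprMn mulrCA.
under [X in _ <= X ^+ _ -> _]eq_bigr do rewrite add0r.
by rewrite -mulr_sumr ger0_norm // exprn_ge0 // invr_ge0.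
Qed.

(* Interpolates the second moment between the first and the fourth by
   [h ^ 2 <= t h + h ^ 4 / t ^ 2], with [t ^ 2] a large multiple of the second. *)
Let avg2_le n (v : 'I_n -> X) : avg v 2 <= 2048 * avg v 1 ^+ 2.
Proof.
set m2 := avg v 2; set m1 := avg v 1.
have m20 : 0 <= m2 by exact: avg_ge0. have m10 : 0 <= m1 by exact: avg_ge0.
have [->|m2N0] := eqVneq m2 0; first by rewrite mulr_ge0 ?exprn_ge0.
have m2_gt0 : 0 < m2 by rewrite lt_neqAle eq_sym m2N0.
set s := Num.sqrt m2; have s0 : 0 < s by rewrite sqrtr_gt0.
have sE : s ^+ 2 = m2 by rewrite sqr_sqrtr.
(* Hypercontractivity with [N = 2]: the factor is 1/4, and its fourth power 1/256. *)
have m4 : avg v 4 <= 256 * s ^+ 4.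
  have : (2^-1 ^+ 2) ^+ 4 * avg v 4 <= (s ^+ 2) ^+ 2.
    by rewrite sE; exact: (@avg_hyper 2 n v isT).
  have -> : (s ^+ 2) ^+ 2 = s ^+ 4 by rewrite -exprM.
  have -> : ((2^-1 ^+ 2) ^+ 4 : R) = 256^-1 by field.
  by clear; lra.
(* The threshold [32 s] makes the quartic term at most [256 / 1024 = 1 / 4] of [s ^ 2], which the
   left side absorbs. *)
have key : m2 <= 32 * s * m1 + (32 * s)^-1 ^+ 2 * avg v 4.
  rewrite /m2 /m1 /avg !mulr_sumr -big_split /=; apply: ler_sum => d _.
  rewrite !(mulrCA _ (sigma_n R d)) -mulrDr; apply: ler_wpM2l; first exact: sigma_n_ge0.
  set h := `|_|; have h0 : 0 <= h by exact: normr_ge0.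
  set t := 32 * s; have t0 : 0 < t by rewrite mulr_gt0.
  rewrite expr1; have [ht|/ltW th] := leP h t.
    apply: ler_wpDr; first by rewrite mulr_ge0 // ?exprn_ge0 // invr_ge0 ltW.
    by rewrite expr2 ler_wpM2r.
  apply: ler_wpDl; first by rewrite mulr_ge0 // ltW.
  have -> : t^-1 ^+ 2 * h ^+ 4 = h ^+ 2 * (h / t) ^+ 2 by rewrite expr_div_n exprVn; ring.
  rewrite -[leLHS]mulr1; apply: ler_wpM2l; first exact: exprn_ge0.
  by apply: exprn_ege1; rewrite ler_pdivlMr // mul1r.
have : (32 * s)^-1 ^+ 2 * avg v 4 <= s ^+ 2 / 4.
  apply: le_trans (ler_wpM2l _ m4) _; first by rewrite exprn_ge0 // invr_ge0 mulr_ge0 // ltW.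
  by rewrite le_eqVlt; apply/orP; left; apply/eqP; field; rewrite gt_eqF.
rewrite -sE in key * => key2.
have : s * (3 * s) <= s * (128 * m1) by rewrite expr2 in key key2; lra.
rewrite ler_pM2l // => s_le.
have -> : 2048 * m1 ^+ 2 = 2048 / (128 ^+ 2) * (128 * m1) ^+ 2 by field.
have : (3 * s) ^+ 2 <= (128 * m1) ^+ 2.
  by apply: lerXn2r => //; rewrite nnegrE mulr_ge0 // ltW.
rewrite exprMn => H; have := exprn_ge0 2 (ltW s0); lra.
Qed.

(** The chain of exponents: [q] to [2 N] by Jensen, [2 N] to 2 by hypercontractivity, 2 to 1 by
    interpolation, 1 to [p] by Jensen again. *)
Lemma kahane p q : 1 <= p -> 1 <= q -> exists2 K : R, 0 < K &
  forall n (v : 'I_n -> X), rad_avg q v <= K * rad_avg p v `^ (q / p).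
Proof.
move=> p1 q1; have p0 : 0 < p by lra. have q0 : 0 < q by lra.
pose N := (Num.truncn q).+1.
have qN : q <= N.*2%:R.
  apply: le_trans (ltW (truncnS_gt q)) _; rewrite ler_nat -/N -addnn; exact: leq_addr.
pose rho : R := (2^-1 ^+ N) ^+ N.*2.
have rho0 : 0 < rho by rewrite !exprn_gt0 // invr_gt0.
pose K := rho^-1 * 2048 ^+ N.
have K0 : 0 < K by apply: mulr_gt0; [rewrite invr_gt0|apply: exprn_gt0; rewrite ltr0n].
pose r := N.*2%:R / q.
have r1 : 1 <= r by rewrite /r ler_pdivlMr // mul1r.
have r0 : 0 < r by lra.
exists (K `^ r^-1) => [|n v]; first exact: powR_gt0.
have m1p : avg v 1 `^ p <= rad_avg p v.
  have := @powR_jensen R _ (@sigma_n R n) (fun d => `|\sum_i sgn R (d i) *: v i|) p p1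
    (@sigma_n_ge0 R n) (fun=> normr_ge0 _) (sum_sigma_n R n).
  by apply: le_trans; rewrite /avg; under eq_bigr do rewrite expr1.
have top : rad_avg q v `^ r <= avg v N.*2.
  apply: le_trans (powR_jensen r1 (@sigma_n_ge0 R n) _ (sum_sigma_n R n)) _.
    by move=> d; exact: powR_ge0.
  apply: ler_sum => d _; rewrite -powRrM.
  have -> : q * r = N.*2%:R by rewrite /r mulrC divfK ?gt_eqF.
  by rewrite powR_mulrn.
have mid : avg v N.*2 <= K * avg v 1 ^+ N.*2.
  have H := @avg_hyper N n v isT; rewrite -/rho in H.
  have H2 : avg v 2 ^+ N <= (2048 * avg v 1 ^+ 2) ^+ N.
    by apply: lerXn2r; rewrite ?avg2_le // nnegrE ?mulr_ge0 ?exprn_ge0 ?avg_ge0.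
  rewrite exprMn -exprM mul2n in H2.
  have := ler_wpM2l (ltW (_ : 0 < rho^-1)) (le_trans H H2).
  by rewrite mulrA mulVf ?gt_eqF // mul1r mulrA invr_gt0; apply.
have all : rad_avg q v `^ r <= (K `^ r^-1 * rad_avg p v `^ (q / p)) `^ r.
  apply: le_trans top (le_trans mid _).
  rewrite powRM ?powR_ge0 // powRVK ?(ltW K0) //; apply: ler_wpM2l; first exact: ltW.
  rewrite -(powR_mulrn _ (avg_ge0 _ _)) -powRrM.
  have -> : q / p * r = p^-1 * N.*2%:R by rewrite /r; field; rewrite !gt_eqF.
  rewrite powRrM; apply: powR_le_mono; [exact: ler0n|exact: avg_ge0|].
  rewrite -[leLHS](powRK p0) ?avg_ge0 //.
  apply: powR_le_mono; [by rewrite invr_ge0 ltW|exact: powR_ge0|exact: m1p].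
rewrite -(powRK r0 (rad_avg_ge0 q v)) powR_rootP ?powR_ge0 //.
by rewrite mulr_ge0 ?powR_ge0.
Qed.


(** Cotype and Kahane bound the q-th powers of the norms by the p-th Rademacher moment, as in
    [cotE]; only the passage from [q] to [p] depends on their order. *)
Lemma finite_cotype_spread p : 1 <= p -> finite_cotype X ->
  exists D s : R, [/\ 0 < D, 0 < s & forall m, (0 < m)%N ->
    spread X p m (D * m%:R^-1 `^ s)].
Proof.
move=> p1 [q [C [q2 [C0 cot]]]].
have q1 : 1 <= q by lra. have q0 : 0 < q by lra. have p0 : 0 < p by lra.
have [K K0 kah] := kahane p1 q1.
have Cq0 : 0 < C `^ q by exact: powR_gt0.
pose E := C `^ q * K; have E0 : 0 < E by exact: mulr_gt0.
have cotE m (w : 'I_m -> X) : \sum_k `|w k| `^ q <= E * rad_avg p w `^ (q / p).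
  have H := cot m w; rewrite powRN mulrC ler_pdivrMr // in H.
  apply: le_trans H _; rewrite mulrC /E -mulrA; apply: ler_wpM2l; first exact: ltW.
  exact: kah.
(* For [p <= q], Jensen over the [m] classes with exponent [q / p] gives [(E / m) ^ (p / q)]. *)
have [pq|qp] := leP p q.
  exists (E `^ (p / q)), (p / q); split; [exact: powR_gt0|exact: divr_gt0|].
  move=> m m0 w; have mR : 0 < m%:R^-1 :> R by rewrite invr_gt0 ltr0n.
  have r0 : 0 < q / p by exact: divr_gt0.
  have r1 : 1 <= q / p by rewrite ler_pdivlMr // mul1r.
  have rV : p / q = (q / p)^-1 by rewrite invf_div.
  rewrite rV -powRM ?(ltW E0) ?(ltW mR) //.
  have Em0 : 0 <= E / m%:R by rewrite mulr_ge0 // ltW.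
  have := @powR_jensen R _ (fun _ : 'I_m => m%:R^-1) (fun k => `|w k| `^ p) (q / p) r1.
  move=> /(_ (fun=> ltW mR) (fun=> powR_ge0 _ _)).
  rewrite sumr_const card_ord -[m%:R^-1 *+ m]mulr_natr mulVf ?gt_eqF ?ltr0n //.
  move=> /(_ erefl); rewrite -!mulr_sumr => J.
  have pqE t : (`|w t| `^ p) `^ (q / p) = `|w t| `^ q.
    by rewrite -powRrM mulrC divfK ?gt_eqF.
  rewrite (eq_bigr _ (fun t _ => pqE t)) in J.
  have J2 := le_trans J (ler_wpM2l (ltW mR) (cotE m w)).
  have S0 : 0 <= m%:R^-1 * \sum_(i < m) `|w i| `^ p.
    by rewrite mulr_ge0 ?(ltW mR) // sumr_ge0 // => i _; exact: powR_ge0.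
  rewrite -(powRK r0 S0) powR_rootP ?powR_ge0 // ?mulr_ge0 ?powR_ge0 ?rad_avg_ge0 //.
  rewrite powRM ?powR_ge0 ?rad_avg_ge0 // powRVK //.
  by apply: le_trans J2 _; rewrite mulrCA mulrA.
(* For [q < p], write [|w k| ^ p] as [|w k| ^ (p - q) |w k| ^ q] and bound the first factor by
   [A ^ ((p - q) / p)]; the full gain [1 / m] survives. *)
exists E, 1; split => // m m0 w.
have mR : 0 < m%:R^-1 :> R by rewrite invr_gt0 ltr0n.
rewrite powRr1 ?(ltW mR) // [E * _]mulrC -mulrA; apply: ler_wpM2l; first exact: ltW.
have r0 := rad_avg_ge0 p w; set A := rad_avg p w in r0 *.
have AE : A = A `^ ((p - q) / p) * A `^ (q / p).
  have [->|AN0] := eqVneq A 0; first by rewrite [X in _ * X]powR0 ?mulr0 // gt_eqF // divr_gt0.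
  rewrite -powRD ?AN0 ?implybT // -mulrDl subrK mulfV ?gt_eqF // powRr1 //.
rewrite [X in _ <= _ * X]AE mulrCA.
apply: le_trans (ler_wpM2l (powR_ge0 _ _) (cotE m w)).
rewrite mulr_sumr; apply: ler_sum => k _.
have wA : `|w k| <= A `^ p^-1.
  rewrite -(powRK p0 (normr_ge0 _)); apply: powR_le_mono;
    rewrite ?powR_ge0 ?invr_ge0 ?(ltW p0) //; exact: normpow_le_rad.
have [->|wN0] := eqVneq `|w k| 0.
  by rewrite powR0 ?gt_eqF // mulr_ge0 ?powR_ge0.
have -> : `|w k| `^ p = `|w k| `^ (p - q) * `|w k| `^ q.
  by rewrite -powRD ?subrK // wN0 implybT.
apply: ler_wpM2r; first exact: powR_ge0.
by rewrite mulrC powRrM; apply: powR_le_mono => //; lra.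
Qed.

End CotypeSpread.

(** * Summation over dyadic scales *)

Section Dyadic.
Variables (R : realType) (a p : R).
Hypotheses (a01 : 0 < a < 1) (p1 : 1 <= p).
Variable X : normedModType R.

Let B := a^-1 + (1 - a)^-1.

(** Telescoping from [T_0] to [T_1] along [r j]. On each interval the length [2 ^ - (j + 1)] cancels
    the growth of the derivative bound, so scale [j] costs only [B c_j ^ (1 / p)]. *)
Lemma Lpnorm_center_dyadic (m : nat -> nat) (c : nat -> R) :
  (forall j, (0 < m j)%N) -> (forall j, 0 <= c j) ->
  (forall j, spread X p (m j) (c j)) ->
  (forall j, m j = 1%N \/ 2 * 2^-1 ^+ j <= (m j)%:R^-1 :> R) ->
  forall n (f : cube n -> X),
  Lpnorm a p (fun x => f x - expect a f) <=
  (B * (\sum_(j < (up_log 2 n).+1) c j `^ p^-1) + 1) * rhs_avg a p f.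
Proof.
move=> m0 c0 sp mj n f; case/andP: (a01) => a0 a1.
have p0 : 0 < p by exact: lt_le_trans p1.
have ia0 : 0 < a^-1 by rewrite invr_gt0.
have i1a0 : 0 < (1 - a)^-1 by rewrite invr_gt0; lra.
have ia1 : 1 <= a^-1 by rewrite invf_ge1 // ltW.
have B1 : 1 <= B by rewrite /B; lra.
set rhs := rhs_avg a p f; have rhs0 : 0 <= rhs by exact: rhs_avg_ge0.
pose r j : R := 1 - 2^-1 ^+ j.
have h0 j : 0 < 2^-1 ^+ j :> R by rewrite exprn_gt0 // invr_gt0.
have h1 j : 2^-1 ^+ j <= 1 :> R by apply: exprn_ile1; [rewrite invr_ge0|lra].
have step j : Lpnorm a p (fun x => noise a (r j.+1) f x - noise a (r j) f x) <=
    B * c j `^ p^-1 * rhs.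
  have hS : 2^-1 ^+ j.+1 = 2^-1 * 2^-1 ^+ j :> R by rewrite exprS.
  have hj := h0 j; have hj1 := h1 j.
  have -> : B * c j `^ p^-1 * rhs =
      (r j.+1 - r j) * ((B * 2 ^+ j.+1) * c j `^ p^-1 * rhs).
    have -> : r j.+1 - r j = (2 ^+ j.+1)^-1 by rewrite /r -exprVn hS; field.
    have : 2 ^+ j.+1 != 0 :> R by rewrite expf_neq0 // pnatr_eq0.
    by move=> ?; field.
  apply: Lpnorm_noise_mvt => //; [rewrite /r; lra|rewrite /r; lra|rewrite /r hS; lra|].
  move=> t /andP[tl tu].
  have p2 : 1 <= 2 ^+ j.+1 :> R by rewrite exprn_ege1 // ler1n.
  (* Since [B] is at least 1 and dominates [1 / a] and [1 / (1 - a)], [M = B 2 ^ (j + 1)] meets all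
     three lower bounds. *)
  apply: (@Lpnorm_dnoise_spread R a p a01 p1 X t (m j) (c j)) => //.
  - by rewrite /r in tl tu; apply/andP; split; lra.
  - by apply: (@le_trans _ _ B); [rewrite /B; lra|apply: ler_peMr => //; lra].
  - by apply: (@le_trans _ _ B); [rewrite /B; lra|apply: ler_peMr => //; lra].
  - apply: (@le_trans _ _ (2 ^+ j.+1)); last by apply: ler_peMl => //; lra.
    have ht : 2^-1 ^+ j.+1 <= 1 - t by rewrite /r in tu; lra.
    rewrite -[2 ^+ _]invrK -exprVn lef_pV2 // posrE //; exact: lt_le_trans ht.
  - case: (mj j) => [->|mj2]; [by left|right; apply: le_trans mj2].
    by apply: ler_wpM2l => //; rewrite /r in tl; lra.
have tele k : Lpnorm a p (fun x => noise a (r k) f x - noise a (r 0) f x) <=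
    (\sum_(j < k) B * c j `^ p^-1) * rhs.
  elim: k => [|k IH].
    by apply: Lpnorm_sup => [//|//||x]; rewrite big_ord0 mul0r // subrr normr0.
  rewrite big_ord_recr /= mulrDl.
  apply: (Lpnorm_triangle a01 p1 _ IH (step k)) => x.
  by apply: le_trans (ler_normD _ _); rewrite [X in _ <= `|X|]addrC subrKA.
(* Then [2 ^ k >= 2 n]: the last interval has length at most [1 / (2 n)], and on it [r >= 1 / 2]
   bounds the derivative by [2 n rhs]. The product accounts for the summand 1. *)
set k := (up_log 2 n).+1.
have last_step : Lpnorm a p (fun x => noise a 1 f x - noise a (r k) f x) <= rhs.
  have hk := h0 k.
  have hk2 : 2^-1 ^+ k <= 2^-1 :> R.
    by rewrite /k exprS ler_piMr // invr_ge0.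
  have nk : 2^-1 ^+ k * (2 * n%:R) <= 1 :> R.
    rewrite exprVn mulrC ler_pdivrMr ?exprn_gt0 // mul1r /k exprS ler_pM2l //.
    by rewrite -natrX ler_nat up_logP.
  have H : Lpnorm a p (fun x => noise a 1 f x - noise a (r k) f x) <=
      (1 - r k) * (2 * n%:R * rhs).
    apply: Lpnorm_noise_mvt => //; [rewrite /r; lra|rewrite /r; lra|].
    move=> t /andP[tl tu]; have t2 : 2^-1 <= t by rewrite /r in tl; lra.
    have t0 : 0 < t by lra.
    apply: le_trans (Lpnorm_dnoise_near1 a01 p1 f _) _; first by rewrite t0.
    rewrite -/rhs; apply: ler_wpM2r => //; apply: ler_wpM2r => //.
    by rewrite -[2]invrK lef_pV2 // posrE // invr_gt0.
  apply: le_trans H _; rewrite mulrA ler_piMl //.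
  by rewrite /r subKr.
rewrite mulrDl mul1r mulr_sumr.
apply: (Lpnorm_triangle a01 p1 _ (tele k) last_step) => x.
apply: le_trans (ler_normD _ _); rewrite noise1 /r expr0 subrr noise0.
by rewrite [X in _ <= `|X|]addrC subrKA.
Qed.

End Dyadic.

(** * Logarithmic and geometric sums, and the final estimates *)

Lemma up_log2_le_ln (R : realType) n :
  (up_log 2 n)%:R <= ln (n%:R : R) / ln 2 + 1.
Proof.
have l2 : 0 < ln (2 : R) by rewrite ln_gt0 // ltr1n.
have [n1|n1] := leqP n 1.
  have -> : up_log 2 n = 0%N by apply/eqP; rewrite up_log_eq0 n1 orbT.
  (* For [n = 0] this uses the convention [ln 0 = 0]. *)
  have -> : ln (n%:R : R) = 0.
    by case: n n1 => [|[|//]] _; [rewrite ln0|rewrite ln1].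
  by rewrite mul0r add0r ler01.
have := up_log_gtn (isT : 1 < 2)%N n1.
have : (0 < up_log 2 n)%N by rewrite up_log_gt0.
case: (up_log 2 n) => // k _ /= kn.
have nR : 0 < n%:R :> R by rewrite ltr0n ltnW.
rewrite -natr1 lerD2r ler_pdivlMr // mulr_natl -lnXn // ler_ln ?posrE ?exprn_gt0 //.
by rewrite -natrX ler_nat ltnW.
Qed.

Lemma sum_geometric_le (R : realFieldType) (t : R) k : 0 <= t -> t < 1 ->
  \sum_(i < k) t ^+ i <= (1 - t)^-1.
Proof.
move=> t0 t1; have t10 : 0 < 1 - t by lra.
rewrite -[leRHS]mul1r ler_pdivlMr //.
have -> : (\sum_(i < k) t ^+ i) * (1 - t) = 1 - t ^+ k.
  by elim: k => [|k IH]; rewrite ?big_ord0 ?big_ord_recr /= ?exprS ?expr0 ?mulrDl ?IH; ring.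
by have := exprn_ge0 k t0; lra.
Qed.

Theorem theorem4p1 (R : realType) :
  (forall a : R, 0 < a < 1 ->
     exists K : R, 0 < K /\
       forall (p : R), 1 <= p ->
       forall (X : normedModType R) (n : nat) (f : cube n -> X),
         Lpnorm a p (fun x => f x - expect a f)
           <= K * (ln (n%:R : R) + 1) * rhs_avg a p f)
  /\
  (forall (a p : R) (X : normedModType R),
     0 < a < 1 -> 1 <= p -> finite_cotype X ->
     exists K : R, 0 < K /\
       forall (n : nat) (f : cube n -> X),
         Lpnorm a p (fun x => f x - expect a f) <= K * rhs_avg a p f).
Proof.
have Bgt0 (a : R) : 0 < a < 1 -> 0 < a^-1 + (1 - a)^-1.
  by case/andP=> a0 a1; rewrite addr_gt0 // invr_gt0 //; lra.
split=> [a a01|a p X a01 p1 cot].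
  set B := a^-1 + (1 - a)^-1; have B0 : 0 < B by exact: Bgt0.
  have l2 : 0 < ln (2 : R) by rewrite ln_gt0 // ltr1n.
  have l2V : 0 < (ln (2 : R))^-1 by rewrite invr_gt0.
  have Bl : 0 < B * (ln 2)^-1 by exact: mulr_gt0.
  (* With a single colour every scale costs [B], and there are [up_log 2 n + 1 <= ln n / ln 2 + 2]
     of them. *)
  exists (B * ((ln 2)^-1 + 2) + 1); split; first by rewrite addr_gt0 // mulr_gt0 // addr_gt0.
  move=> p p1 X n f.
  have H := @Lpnorm_center_dyadic R a p a01 p1 X (fun=> 1%N) (fun=> 1) (fun=> isT)
    (fun=> ler01) (fun=> @spread1 R X p p1) (fun=> or_introl erefl) n f.
  apply: le_trans H _; rewrite -/B; apply: ler_wpM2r; first exact: rhs_avg_ge0.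
  rewrite powR1 sumr_const card_ord -natr1.
  have lnn0 : 0 <= ln (n%:R : R).
    by case: n f => [|n] f; [rewrite ln0|apply: ln_ge0; rewrite ler1n].
  have := ler_wpM2l (ltW B0) (up_log2_le_ln R n).
  have := mulr_ge0 (ltW Bl) lnn0; have := mulr_ge0 (ltW B0) lnn0.
  have -> : B * (ln n%:R / ln 2 + 1) = B * (ln 2)^-1 * ln n%:R + B by ring.
  lra.
set B := a^-1 + (1 - a)^-1; have B0 : 0 < B by exact: Bgt0.
have p0 : 0 < p by lra.
have [D [s [D0 s0 sp]]] := finite_cotype_spread p1 cot.
pose t : R := 2^-1 `^ (s / p).
have t0 : 0 < t by apply: powR_gt0; rewrite invr_gt0.
have t1 : t < 1.
  have := @gt0_ltr_powR R (s / p) (divr_gt0 s0 p0) 2^-1 1.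
  by rewrite powR1; apply; rewrite ?nnegrE ?invr_ge0 //; lra.
have d0 : 0 < D `^ p^-1 by exact: powR_gt0.
(* The largest number of colours compatible with [2 * 2 ^ - j <= 1 / m]; at [j = 0] the truncated
   predecessor gives one colour. The costs then decay geometrically with ratio [t]. *)
pose m j := (2 ^ j.-1)%N.
have m0 j : (0 < m j)%N by rewrite expn_gt0.
pose c j := D * (m j)%:R^-1 `^ s.
have c0 j : 0 <= c j by rewrite mulr_ge0 ?powR_ge0 // ltW.
have cE j : c j `^ p^-1 = D `^ p^-1 * t ^+ j.-1.
  rewrite /c powRM ?powR_ge0 ?(ltW D0) // -powRrM; congr (_ * _).
  rewrite -[RHS]powR_mulrn ?powR_ge0 // /t powRAC powR_mulrn ?invr_ge0 //.
  by rewrite /m natrX exprVn.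
have mj j : m j = 1%N \/ 2 * 2^-1 ^+ j <= (m j)%:R^-1 :> R.
  case: j => [|j]; [by left|right]; rewrite /m natrX -exprVn exprS mulrA mulfV ?mul1r //.
  by rewrite pnatr_eq0.
have tV : 0 < (1 - t)^-1 by rewrite invr_gt0; lra.
(* Scales 0 and 1 both have exponent 0, hence the additional 1 next to the geometric series. *)
exists (B * (D `^ p^-1 * (1 + (1 - t)^-1)) + 1); split.
  by rewrite addr_gt0 // !mulr_gt0 // addr_gt0.
move=> n f.
apply: le_trans (Lpnorm_center_dyadic a01 p1 m0 c0 (fun j => sp _ (m0 j)) mj f) _.
rewrite -/B; apply: ler_wpM2r; first exact: rhs_avg_ge0.
rewrite lerD2r; apply: ler_wpM2l; first exact: ltW.
under eq_bigr do rewrite cE.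
rewrite -mulr_sumr; apply: ler_wpM2l; first exact: ltW.
rewrite big_ord_recl expr0 lerD2l.
exact: sum_geometric_le (ltW t0) t1.
Qed.
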